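(* Let $n \geq 3$, let $e_1,\dots,e_n$ be the standard basis of $\mathbb{R}^n$, and let $\Gamma_0 = \{A \in \mathrm{SL}(n,\mathbb{Z}) \mid Ae_1 = e_1\} < \mathrm{SL}(n,\mathbb{R})$. Then the linear action $\Gamma_0 \curvearrowright \mathbb{R}^n$ is ergodic.
   Context: Ergodicity is with respect to Lebesgue measure on $\mathbb{R}^n$: every $\Gamma_0$-invariant Borel set is null or conull. *)

(* Defs.v *)
From HB Require Import structures.
From mathcomp Require Import all_boot all_order all_algebra.
From mathcomp Require Import all_classical all_reals all_analysis.
From mathcomp Require Import measurable_realfun.

Set Implicit Arguments.
Unset Strict Implicit.
Unset Printing Implicit Defensive.

Import Order.TTheory GRing.Theory Num.Theory.
Import numFieldNormedType.Exports.

Local Open Scope classical_set_scope.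
Local Open Scope ring_scope.

(* R^n as column vectors, with the Borel sigma-algebra of the usual topology. *)
Definition open_cV (R : realType) (n : nat) : set (set 'cV[R]_n) :=
  [set U | open U].

Notation borel_cV R n := (g_sigma_algebraType (@open_cV R n)).

Section cons_cV.
Variables (R : realType) (n : nat).

Definition cons_cV (p : measurableTypeR R * borel_cV R n) : borel_cV R n.+1 :=
  \col_i if unlift ord0 i is Some j then (p.2 : 'cV[R]_n) j ord0 else p.1.

Definition uncons_cV (x : borel_cV R n.+1) : measurableTypeR R * borel_cV R n :=
  ((x : 'cV[R]_n.+1) ord0 ord0,
   \col_j (x : 'cV[R]_n.+1) (lift ord0 j) ord0).

Lemma cons_cVK : cancel cons_cV uncons_cV.
Proof.
case=> a y; rewrite /uncons_cV /cons_cV !mxE unlift_none; congr pair.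
by apply/colP => j; rewrite !mxE liftK.
Qed.

Lemma open_borel_cV m (U : set 'cV[R]_m) :
  open U -> measurable (U : set (borel_cV R m)).
Proof. by move=> oU; exact: sub_sigma_algebra. Qed.

Lemma open_ball_cV m (x : 'cV[R]_m) (e : R) : open (ball x e).
Proof.
rewrite openE => y [e0 xy].
have H (i : 'I_m) : nbhs y [set z : 'cV[R]_m | ball (x i ord0) e (z i ord0)].
  apply: (@coord_continuous R m 1 i ord0 y).
  by apply: open_nbhs_nbhs; split; [exact: ball_open|exact: xy].
apply: filterS (@filter_forall _ _ _ _ (nbhs_filter y) H) => z xz.
by split=> // i j; rewrite (ord1 j); exact: xz.
Qed.

Lemma measurable_uncons_cV : measurable_fun setT uncons_cV.
Proof.
apply: measurable_fun_pair => /=.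
- apply: (@measurability _ _ _ _ _ _ _).
    exact: RGenOpens.measurableE.
  move=> _ [_ [a [b ->]] <-]; rewrite setTI; apply: open_borel_cV.
  apply: (@open_comp _ _ (fun x : 'cV[R]_n.+1 => x ord0 ord0)).
    by move=> x _; exact: coord_continuous.
  exact: interval_open.
- apply: (@measurability _ _ _ (borel_cV R n) _ _ (@open_cV R n)) => //.
  move=> _ [U oU <-]; rewrite setTI; apply: open_borel_cV.
  apply: (@open_comp _ _
    (fun x : 'cV[R]_n.+1 => \col_j x (lift ord0 j) ord0)) => //.
  move=> x _ A /nbhs_ballP[e e0 sA]; apply/nbhs_ballP; exists e => // z [_ xz].
  by apply: sA; split=> // i j; rewrite !mxE; exact: xz.
Qed.

Lemma measurable_cons_cV : measurable_fun setT cons_cV.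
Proof.
apply: (@measurability _ _ _ (borel_cV R n.+1) _ _ (@open_cV R n.+1)) => //.
move=> _ [U oU <-]; rewrite setTI.
pose c (q : 'cV[rat]_n.+1) : 'cV[R]_n.+1 := map_mx ratr q.
pose r (k : nat) : R := k.+1%:R^-1.
have r0 k : 0 < r k by rewrite invr_gt0.
pose box q k : set (measurableTypeR R * borel_cV R n) :=
  ball (c q ord0 ord0) (r k) `*`
  ball (\col_j c q (lift ord0 j) ord0 : 'cV[R]_n) (r k).
have boxE q k : cons_cV @^-1` ball (c q) (r k) = box q k.
  apply/seteqP; split=> -[a y] /=.
    move=> [_ H]; split=> [|/=].
      by have := H ord0 ord0; rewrite [X in ball _ _ X]mxE unlift_none.
    split=> // i j; rewrite (ord1 j) mxE; have := H (lift ord0 i) ord0.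
    by rewrite [X in ball _ _ X]mxE liftK.
  move=> [/= Ha [_ Hy]]; split=> // i j; rewrite ord1 {j}.
  rewrite [X in ball _ _ X]mxE; case: unliftP => [j ->|-> //].
  by have := Hy j ord0; rewrite mxE.
have mbox q k : measurable (box q k).
  apply: measurableX; first exact: measurable_ball.
  by apply: open_borel_cV; exact: open_ball_cV.
pose F (i : 'cV[rat]_n.+1 * nat) :=
  if pselect (ball (c i.1) (r i.2) `<=` U) then box i.1 i.2 else set0.
rewrite (_ : _ @^-1` _ = \bigcup_i F i).
  apply: countable_bigcupT_measurable => // i.
  by rewrite /F; case: pselect => /= *; [exact: mbox|].
apply/seteqP; split=> [p /= Up|p [[q k] _]]; last first.
  by rewrite /F; case: pselect => //= sU; rewrite -boxE => /sU.
have : nbhs (cons_cV p : 'cV[R]_n.+1) U by exact: open_nbhs_nbhs.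
move=> /nbhs_ballP[e /= e0 sU].
have [k ke] : exists k, r k < e / 2.
  have [k _ /(_ k (leqnn _)) ke] :=
    near_infty_natSinv_lt (PosNum (divr_gt0 e0 (ltr0Sn R 1))).
  by exists k.
have /choice[q qP] (i : 'I_n.+1) : exists q : rat,
    ball ((cons_cV p : 'cV[R]_n.+1) i ord0) (r k) (ratr q : R).
  have x0 : ball ((cons_cV p : 'cV[R]_n.+1) i ord0) (r k) !=set0.
    by eexists; exact: ballxx.
  have [z [xz [q _ qz]]] := dense_rat x0 (ball_open _ _).
  by exists q; rewrite qz.
have pq : ball (c (\col_i q i)) (r k) (cons_cV p).
  split=> // i j; rewrite (ord1 j); apply: ball_sym.
  by rewrite [X in ball _ _ X]mxE [X in ratr X]mxE; exact: qP.
exists (\col_i q i, k) => //; rewrite /F; case: pselect => /= [_|[]].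
  by rewrite -boxE.
move=> z qz; apply: sU; rewrite (splitr e).
apply: (ball_triangle (y := c (\col_i q i))).
  by apply: (@le_ball _ _ _ (r k)); [exact: ltW|exact/ball_sym/pq].
by apply: (@le_ball _ _ _ (r k)); [exact: ltW|exact: qz].
Qed.
End cons_cV.

Section lebesgue_cons.
Local Open Scope ereal_scope.
Variables (R : realType) (n : nat).
Variable mu : {sigma_finite_measure set (borel_cV R n) -> \bar R}.

Definition lebesgue_cons : set (borel_cV R n.+1) -> \bar R :=
  pushforward (lebesgue_measure \x mu) (@cons_cV R n).

Let measurable_cons_preimage (A : set (borel_cV R n.+1)) :
  measurable A -> measurable (@cons_cV R n @^-1` A).
Proof.
by move=> mA; rewrite -[X in measurable X]setTI; exact: measurable_cons_cV.
Qed.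

Let lebesgue_cons0 : lebesgue_cons set0 = 0.
Proof. by rewrite /lebesgue_cons /pushforward preimage_set0 measure0. Qed.

Let lebesgue_cons_ge0 A : 0 <= lebesgue_cons A.
Proof. exact: (measure_ge0 (lebesgue_measure \x mu)). Qed.

Let lebesgue_cons_sigma_additive : semi_sigma_additive lebesgue_cons.
Proof.
move=> F mF tF mUF; rewrite /lebesgue_cons /pushforward preimage_bigcup.
apply: measure_semi_sigma_additive.
- by move=> k; exact: measurable_cons_preimage.
- apply/trivIsetP => /= i j _ _ ij; rewrite -preimage_setI.
  by move/trivIsetP : tF => /(_ _ _ _ _ ij) ->//; rewrite preimage_set0.
- by rewrite -preimage_bigcup; exact: measurable_cons_preimage.
Qed.

HB.instance Definition _ := isMeasure.Build _ _ _ lebesgue_cons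
  lebesgue_cons0 lebesgue_cons_ge0 lebesgue_cons_sigma_additive.

Let lebesgue_cons_sigma_finite : sigma_finite setT lebesgue_cons.
Proof.
have /sigma_finiteP[F [FT ndF Foo]] := sigma_finiteT (@lebesgue_measure R).
have /sigma_finiteP[G [GT ndG Goo]] := sigma_finiteT mu.
exists (fun k => @uncons_cV R n @^-1` (F k `*` G k)) => [|k].
  rewrite -preimage_bigcup; apply/esym/seteqP; split=> // x _ /=.
  case: (uncons_cV x) => a y.
  have [i _ Fi] : (\bigcup_k F k) a by rewrite -FT.
  have [j _ Gj] : (\bigcup_k G k) y by rewrite -GT.
  exists (maxn i j) => //; split => /=.
  - by move: a Fi; exact/subsetPset/ndF/leq_maxl.
  - by move: y Gj; exact/subsetPset/ndG/leq_maxr.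
have [[mF Fk] [mG Gk]] := (Foo k, Goo k); split.
  rewrite -[X in measurable X]setTI; apply: measurable_uncons_cV => //.
  exact: measurableX.
rewrite /lebesgue_cons /pushforward -comp_preimage.
rewrite (_ : _ \o _ = id); last by apply/funext; exact: cons_cVK.
rewrite preimage_id product_measure1E//.
by rewrite lte_mul_pinfty// ge0_fin_numE.
Qed.

HB.instance Definition _ := @Measure_isSigmaFinite.Build _ _ _ lebesgue_cons
  lebesgue_cons_sigma_finite.

End lebesgue_cons.

(* Lebesgue measure on R^n, as the n-fold product of the one on R; R^0 is a
   point, of mass 1. *)
Fixpoint lebesgue_cV (R : realType) (n : nat) :
    {sigma_finite_measure set (borel_cV R n) -> \bar R} :=
  if n is m.+1 then lebesgue_cons (lebesgue_cV R m)
  else \d_((0 : 'cV[R]_0) : borel_cV R 0).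

Definition box_cV (R : realType) (n : nat)
    (B : 'I_n -> set (measurableTypeR R)) : set (borel_cV R n) :=
  [set x | forall i, B i ((x : 'cV[R]_n) i ord0)].

Lemma box_cVS (R : realType) (n : nat)
    (B : 'I_n.+1 -> set (measurableTypeR R)) :
  box_cV B =
  @uncons_cV R n @^-1` (B ord0 `*` box_cV (fun i => B (lift ord0 i))).
Proof.
apply/seteqP; split=> x /=; first by move=> Bx; split=> // i; rewrite mxE.
move=> [B0 Bx] i; case: (unliftP ord0 i) => [j|] -> //.
by have := Bx j; rewrite mxE.
Qed.

Lemma measurable_box_cV (R : realType) (n : nat)
    (B : 'I_n -> set (measurableTypeR R)) :
  (forall i, measurable (B i)) -> measurable (box_cV B).
Proof.
elim: n B => [B _|n IHn B mB].
  by rewrite (_ : box_cV B = setT)//; apply/seteqP; split=> // x _ [].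
rewrite box_cVS -[X in measurable X]setTI; apply: measurable_uncons_cV => //.
by apply: measurableX => //; exact: IHn.
Qed.

Lemma lebesgue_cV_box (R : realType) (n : nat)
    (B : 'I_n -> set (measurableTypeR R)) :
  (forall i, measurable (B i)) ->
  lebesgue_cV R n (box_cV B) = (\prod_(i < n) lebesgue_measure (B i))%E.
Proof.
elim: n B => [B _|n IHn B mB].
  rewrite big_ord0 (_ : box_cV B = setT) /=; first by rewrite diracT.
  by apply/seteqP; split=> // x _ [].
rewrite big_ord_recl -IHn//= /lebesgue_cons /pushforward box_cVS -comp_preimage.
rewrite (_ : _ \o _ = id); last by apply/funext; exact: cons_cVK.
by rewrite preimage_id product_measure1E//; exact: measurable_box_cV.
Qed.

Definition ergodic_action d (T : measurableType d) (R : realType) (G : Type)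
    (mu : {measure set T -> \bar R}) (S : set G) (act : G -> T -> T) : Prop :=
  forall A : set T, measurable A -> (forall g, S g -> act g @` A = A) ->
    (mu A = 0 \/ mu (~` A) = 0)%E.

Definition SLZ (R : realType) (n : nat) : set 'M[R]_n :=
  [set map_mx intr A | A in [set A : 'M[int]_n | \det A = 1]].

(* Indexing starts at 0: this is the first basis vector as soon as n > 0. *)
Definition e1 (R : realType) (n : nat) : 'cV[R]_n :=
  \col_i ((i == 0 :> nat)%N%:R).

Definition Gamma0 (R : realType) (n : nat) : set 'M[R]_n :=
  [set A | SLZ A /\ A *m e1 R n = e1 R n].

Definition linear_action (R : realType) (n : nat) (A : 'M[R]_n)
  (x : borel_cV R n) : borel_cV R n := A *m (x : 'cV[R]_n).

(* Main.v *)
Require Import Defs.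
From mathcomp Require Import all_boot all_order all_algebra.
From mathcomp Require Import all_classical all_reals all_analysis.
From mathcomp Require Import measurable_realfun ring lra zify.

Set Implicit Arguments.
Unset Strict Implicit.
Unset Printing Implicit Defensive.

Import Order.TTheory GRing.Theory Num.Theory.
Import numFieldNormedType.Exports.

Local Open Scope classical_set_scope.
Local Open Scope ring_scope.

(** Write R^(n+1) = R x R^n and a vector as (t, y). The matrices fixing e_1
    are the block matrices (1 b; 0 D) with b an integer row and D in SL(n, Z),
    and they send (t, y) to (t + b y, D y). If y_0 and y_1 are linearly
    independent over Q, which holds for almost every y, the numbers b y are
    dense in the line, so the fibre over y of an invariant set A is null or
    conull ([periodic_null_conull]). The y whose fibre is null form an
    SL(n, Z)-invariant set, and Fubini reduces the ergodicity of Gamma_0 on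
    R^(n+1) to the ergodicity of SL(n, Z) on R^n ([Gamma0_ergodic_of_SLZ]).
    As SL(n+1, Z) contains Gamma_0, induction on n leaves the action of
    SL(2, Z) on the plane ([plane_ergodic]).

    For an invariant subset B of the plane, let h(a, b) be the area of B in the
    triangle x, y > 0, a x + b y < 1. The diagonal cuts the open quadrant into
    its images under the shears (x, y) -> (x + y, y) and (x, y) -> (x, x + y),
    and pulling back by these area-preserving maps gives
    h(a, b) = h(a, a + b) + h(a + b, b). Equivalently, k = a b h is a bounded
    harmonic function of the Markov chain that moves from (a, b) to (a + b, b)
    with probability a / (a + b) and to (a, a + b) with probability
    b / (a + b). Moreover k varies slowly when a and b are multiplied by factors
    close to 1. Such a function is constant ([density_function_cst]), by an
    argument of Choquet-Deny type: from any point (a, b) with a and b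
    comparable, the chain visits every multiplicative neighbourhood of every
    far away diagonal point with positive probability. Hence B occupies the
    same proportion r of every triangle.

    The cone of the directions between the vertical axis and a rational slope
    is cut by Euclid's algorithm into images of the quadrant under products of
    shears, so B occupies the proportion r of every such cone truncated by a
    line x + y = s. These truncated cones form a pi-system that generates the
    Borel sets of the quadrant, so B occupies the proportion r of every Borel
    subset E ([area_triangle_proportional]). The choice E = B shows that B has
    no area in the quadrant unless r = 1. The quarter turn is a product of
    shears and carries the conclusion to the whole plane. *)

(** * Harmonic functions of Euclid's algorithm *)

Section liouville.
Variable R : realType.
Implicit Types (k g u : R -> R -> R).

(** Harmonicity for the Markov chain with transition probabilities a / (a + b)
    and b / (a + b), cleared of denominators. *)
Definition euclid_harmonic k := forall a b, 0 < a -> 0 < b ->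
  (a + b) * k a b = a * k (a + b) b + b * k a (a + b).

Definition quadrant_sup g M := (forall a b, 0 < a -> 0 < b -> g a b <= M) /\
  (forall e, 0 < e -> exists a b, [/\ 0 < a, 0 < b & M - e < g a b]).

Lemma quadrant_sup_exists g c : (forall a b, 0 < a -> 0 < b -> g a b <= c) ->
  exists M, quadrant_sup g M.
Proof.
move=> gc; pose E := [set r | exists a b, [/\ 0 < a, 0 < b & r = g a b]].
have supE : has_sup E.
  split; first by exists (g 1 1), 1, 1; split.
  by exists c => _ [a [b [a0 b0 ->]]]; exact: gc.
exists (sup E); split=> [a b a0 b0|e e0].
  by apply: ub_le_sup; [exact: supE.2|exists a, b].
have [_ [a [b [a0 b0 ->]]] h] := sup_adherent e0 supE.
by exists a, b.
Qed.

Lemma euclid_harmonic_sub k1 k2 : euclid_harmonic k1 -> euclid_harmonic k2 ->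
  euclid_harmonic (fun a b => k1 a b - k2 a b).
Proof.
by move=> h1 h2 a b a0 b0; have := h1 _ _ a0 b0; have := h2 _ _ a0 b0; lra.
Qed.

Lemma euclid_harmonic_cst c : euclid_harmonic (fun _ _ => c).
Proof. by move=> a b _ _; ring. Qed.

Lemma euclid_harmonic_scale k t : 0 < t -> euclid_harmonic k ->
  euclid_harmonic (fun a b => k (t * a) (t * b)).
Proof.
move=> t0 h a b a0 b0; have := h (t * a) (t * b).
rewrite -mulrDr -!mulrA -mulrDr => /(_ (mulr_gt0 t0 a0) (mulr_gt0 t0 b0)) H.
exact: (mulfI (lt0r_neq0 t0)).
Qed.

Lemma euclid_harmonic_swap k : euclid_harmonic k ->
  euclid_harmonic (fun a b => k b a).
Proof.
by move=> h a b a0 b0; rewrite [in LHS]addrC h// addrC [b + a]addrC.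
Qed.

(** The chain started at (a, b) makes n moves to (a, b + n a) with probability
    b / (b + n a), as the product of the weights telescopes; the excursions away
    from this ray contribute nonnegative terms. *)
Lemma euclid_harmonic_ray_le u a b n : euclid_harmonic u -> 0 < a -> 0 < b ->
  (forall c, b <= c -> 0 <= u (a + c) c) ->
  b * u a (b + n%:R * a) <= (b + n%:R * a) * u a b.
Proof.
move=> hu a0 b0 u0; elim: n => [|n IHn]; first by rewrite mul0r addr0.
have na0 : 0 <= n%:R * a by rewrite mulr_ge0// ltW.
have c0 : 0 < b + n%:R * a by rewrite ltr_wpDr.
have := hu a _ a0 c0; have := u0 (b + n%:R * a).
rewrite lerDl => /(_ na0).
rewrite (_ : b + n.+1%:R * a = a + (b + n%:R * a)); last first.
  by rewrite -natr1; ring.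
move: IHn c0; set c := b + n%:R * a => IHn c0 u1 e.
have cu : c * u a (a + c) <= (a + c) * u a c.
  by rewrite e lerDr mulr_ge0// ltW.
rewrite -(ler_pM2l c0); apply: le_trans (_ : (a + c) * (b * u a c) <= _).
  by rewrite mulrCA [leRHS]mulrCA ler_pM2l.
rewrite [leRHS]mulrCA ler_pM2l//; lra.
Qed.

(** A maximum principle: the chain almost surely visits the region where the
    coordinates are comparable, since it can only avoid it by going forever
    along the ray of the previous lemma, where the factor b / (b + n a)
    multiplied by the lower bound tends to 0. *)
Lemma euclid_harmonic_ge0_balanced u c : euclid_harmonic u ->
  (forall a b, 0 < a -> 0 < b -> - c <= u a b) ->
  (forall a b, 0 < a -> 0 < b -> a <= 2 * b -> b <= 2 * a -> 0 <= u a b) ->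
  forall a b, 0 < a -> 0 < b -> 0 <= u a b.
Proof.
move=> hu uc ub a b a0 b0.
wlog ab : u hu uc ub a b a0 b0 / a <= b.
  move=> H; have [/H|/ltW] := leP a b; first exact.
  (* the hypotheses on u are symmetric in a and b *)
  apply: (H (fun a b => u b a)) => //; first exact: euclid_harmonic_swap.
    by move=> *; exact: uc.
  by move=> *; exact: ub.
rewrite leNgt; apply/negP => u0.
pose n := (Num.truncn (b * c / (- u a b * a))).+1.
have ltn : b * c / (- u a b * a) < n%:R by exact: truncnS_gt.
have h1 : b * u a (b + n%:R * a) <= (b + n%:R * a) * u a b.
  by apply: euclid_harmonic_ray_le => // d bd; apply: ub; lra.
have na0 : 0 <= n%:R * a by rewrite mulr_ge0// ltW.
have := uc a (b + n%:R * a) a0 (ltr_wpDr na0 b0).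
move: ltn; rewrite ltr_pdivrMr; last by rewrite mulr_gt0// oppr_gt0.
nra.
Qed.

(** Nearly maximal values propagate. At a point (a, b) with comparable
    coordinates, the deficit M - g is nonnegative and harmonic, so a small value
    there forces a small value at each point that the chain reaches with a
    probability bounded below. The points reached are (L + a, L) with
    L = b + m a; they approximate a whole segment of the diagonal, of ratio X
    as large as desired, once L is large compared to a. *)
Lemma near_sup_diagonal g M X e : euclid_harmonic g ->
  quadrant_sup g M -> 1 <= X -> 0 < e ->
  exists2 s, 0 < s & forall l, s <= l <= X * s -> exists p q,
    [/\ l <= p <= (1 + e) * l, l <= q <= (1 + e) * l & M - e <= g p q].
Proof.
move=> hg [gM gsup] X1 e0.
(* beyond K a, a displacement by 2 a is a relative error of at most e *)
pose K : R := 2 + 2 / e.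
have K2 : 2 <= K by rewrite lerDl divr_ge0// ltW.
have Ke : 2 <= e * K.
  by rewrite /K mulrDr [e * (2 / e)]mulrC divfK ?gt_eqF// lerDr; lra.
(* the chain goes from (a, b) to (L + a, L) with probability
   a b / (L (L + a)), which is at least 1 / (2 (X K + 2)^2) *)
pose d := e / (2 * (X * K + 2) ^+ 2).
have P0 : 0 < X * K + 2 by nra.
have d0 : 0 < d by rewrite divr_gt0// mulr_gt0// exprn_gt0.
have hu : euclid_harmonic (fun a b => M - g a b).
  by apply: euclid_harmonic_sub => //; exact: euclid_harmonic_cst.
have u0 a b : 0 < a -> 0 < b -> 0 <= M - g a b.
  by move=> a0 b0; have := gM _ _ a0 b0; lra.
have [a [b [a0 b0 ab ba gab]]] :
    exists a b, [/\ 0 < a, 0 < b, a <= 2 * b, b <= 2 * a & M - d < g a b].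
  apply: contrapT => no.
  have [a [b [a0 b0 gab]]] := gsup _ d0.
  have : 0 <= (M - d) - g a b; last lra.
  apply: (@euclid_harmonic_ge0_balanced (fun a b => (M - d) - g a b) d) => //.
  - by apply: euclid_harmonic_sub => //; exact: euclid_harmonic_cst.
  - by move=> x y x0 y0; have := gM _ _ x0 y0; lra.
  move=> x y x0 y0 xy yx; rewrite leNgt; apply/negP => h; apply: no.
  by exists x, y; split => //; lra.
exists (K * a) => [|l /andP[Kal lXKa]]; first by rewrite mulr_gt0//; lra.
have bl : b <= l by nra.
(* L is the first term above l of the progression of step a *)
pose m := Num.truncn ((l - b) / a); pose L := b + m.+1%:R * a.
have la : 0 <= (l - b) / a by rewrite divr_ge0 ?subr_ge0// ltW.
have /andP[mla lma] := truncn_itv la.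
rewrite -/m ler_pdivlMr// in mla; rewrite -/m ltr_pdivrMr// in lma.
have lL : l <= L by rewrite /L; lra.
have Ll : L <= l + a by rewrite /L -natr1; lra.
exists (L + a), L; split; [by apply/andP; split; nra| by apply/andP; split; nra|].
have L0 : 0 < L by lra.
have h1 : b * (M - g a L) <= L * (M - g a b).
  by apply: (euclid_harmonic_ray_le _ hu) => // y yb; apply: u0; lra.
have := hu a L a0 L0 => h2.
have h3 := u0 a (a + L) a0 (addr_gt0 a0 L0).
have h4 : a * (M - g (a + L) L) <= (a + L) * (M - g a L).
  by rewrite h2 lerDl mulr_ge0// ltW.
have h5 : b * a * (M - g (L + a) L) <= (a + L) * L * d.
  have h4b : b * (a * (M - g (a + L) L)) <= b * ((a + L) * (M - g a L)).
    by rewrite ler_pM2l.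
  rewrite [L + a]addrC -!mulrA; apply: (le_trans h4b).
  rewrite mulrCA ler_pM2l; last lra.
  apply: (le_trans h1).
  by rewrite ler_pM2l//; lra.
have h6 : (a + L) * L <= (X * K + 2) ^+ 2 * a ^+ 2.
  have : a + L <= (X * K + 2) * a by lra.
  by rewrite -exprMn expr2 => h; apply: ler_pM; lra.
have h7 : b * a * (M - g (L + a) L) <= b * a * e.
  apply: (le_trans h5); apply: (le_trans (ler_wpM2r (ltW d0) h6)).
  rewrite (_ : _ * d = e / 2 * a * a).
    rewrite (_ : b * a * e = e / 2 * a * (2 * b)); last by field.
    by rewrite ler_pM2l// mulr_gt0//; lra.
  rewrite /d; move: P0; move: (X * K + 2) => P P0.
  by field; rewrite gt_eqF.
by move: h7; rewrite ler_pM2l ?mulr_gt0//; lra.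
Qed.

(** The properties of the densities of an invariant set in the triangles with
    vertices 0, (1/a, 0) and (0, 1/b) from which constancy follows; they are
    preserved by k -> 1 - k. *)
Record density_function k : Prop := DensityFunction {
  df_harmonic : euclid_harmonic k ;
  df_bounds : forall a b, 0 < a -> 0 < b -> 0 <= k a b <= 1 ;
  df_lip : forall a b a' b' e, 0 < a -> 0 < b -> 0 <= e <= 1 ->
    a <= a' <= (1 + e) * a -> b <= b' <= (1 + e) * b ->
    `|k a' b' - k a b| <= 3 * e }.

Lemma density_functionC k : density_function k ->
  density_function (fun a b => 1 - k a b).
Proof.
case=> hk k01 lk; split.
- by apply: euclid_harmonic_sub => //; exact: euclid_harmonic_cst.
- by move=> a b a0 b0; have := k01 _ _ a0 b0; lra.
- move=> a b a' b' e a0 b0 e0 aa bb.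
  by rewrite opprB addrC addrA subrK distrC; exact: lk.
Qed.

(** The argument of Choquet and Deny. The increment
    g(x, y) = k(t x, t y) - k(x, y) is harmonic as well. If its supremum M were
    positive, the increments would be at least M / 2 at all the diagonal points
    (t^j s, t^j s) with j < n simultaneously, and k, which is bounded by 1,
    would grow by at least n M / 2 from (s, s) to (t^n s, t^n s). *)
Lemma density_function_scale_le k t a b : density_function k -> 1 <= t ->
  0 < a -> 0 < b -> k (t * a) (t * b) <= k a b.
Proof.
case=> hk k01 lk t1 a0 b0; have t0 : 0 < t by lra.
pose g x y := k (t * x) (t * y) - k x y.
have hg : euclid_harmonic g.
  by apply: euclid_harmonic_sub => //; exact: euclid_harmonic_scale.
have g1 x y : 0 < x -> 0 < y -> -1 <= g x y <= 1.
  move=> x0 y0; have := k01 _ _ x0 y0.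
  by have := k01 _ _ (mulr_gt0 t0 x0) (mulr_gt0 t0 y0); rewrite /g; lra.
have [M supM] : exists M, quadrant_sup g M.
  by apply: (@quadrant_sup_exists _ 1) => x y x0 y0; case/andP: (g1 x y x0 y0).
suff M0 : M <= 0 by have := supM.1 a b a0 b0; rewrite /g; lra.
rewrite leNgt; apply/negP => M0.
have M1 : M <= 1.
  rewrite leNgt; apply/negP => M1.
  have [|x [y [x0 y0]]] := supM.2 (M - 1); first by lra.
  by have := g1 _ _ x0 y0; lra.
(* an increment near (l, l) is within 6 e of the increment at (l, l), so that
   what remains of M is at least M - 7 e = M / 2 *)
pose e := M / 14; have e0 : 0 < e by rewrite divr_gt0.
have e1 : 0 <= e <= 1 by rewrite /e; lra.
pose n := (Num.truncn (2 / M)).+1.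
have nM : 2 < n%:R * M by rewrite -ltr_pdivrMr//; exact: truncnS_gt.
have [s s0 hs] := near_sup_diagonal hg supM (exprn_ege1 n t1) e0.
pose m j := k (t ^+ j * s) (t ^+ j * s).
have step j : (j < n)%N -> M / 2 <= m j.+1 - m j.
  move=> jn.
  have l0 : 0 < t ^+ j * s by rewrite mulr_gt0// exprn_gt0.
  have [|p [q [pl ql Mpq]]] := hs (t ^+ j * s).
    by rewrite ler_peMl ?(ltW s0) ?exprn_ege1//= ler_pM2r// ler_weXn2l// ltnW.
  have [p0 q0] : 0 < p /\ 0 < q by lra.
  have := lk _ _ p q e l0 l0 e1 pl ql.
  have tl0 : 0 < t ^+ j.+1 * s by rewrite mulr_gt0// exprn_gt0.
  have := lk _ _ (t * p) (t * q) e tl0 tl0 e1.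
  rewrite -/(m j) -/(m j.+1) exprS -[t * _ * s]mulrA ![_ * (t * _)]mulrCA.
  rewrite !ler_pM2l// => /(_ pl ql).
  move: Mpq; rewrite /g !ler_norml /e; lra.
have : forall j, (j <= n)%N -> j%:R * (M / 2) <= m j - m 0%N.
  elim=> [_|j IHj jn]; first by rewrite mul0r subrr.
  by have := IHj (ltnW jn); have := step j jn; rewrite -natr1; lra.
move=> /(_ n (leqnn n)).
have mk j : 0 <= m j <= 1.
  by apply: k01; rewrite mulr_gt0// exprn_gt0.
by have := mk n; have := mk 0%N; lra.
Qed.

Lemma density_function_scale k t a b : density_function k -> 0 < t ->
  0 < a -> 0 < b -> k (t * a) (t * b) = k a b.
Proof.
move=> dk t0 a0 b0; wlog t1 : t t0 a b a0 b0 / 1 <= t.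
  move=> H; have [|/ltW t1] := leP 1 t; first exact: H.
  have /(H (t^-1)) : 0 < t^-1 by rewrite invr_gt0.
  move=> /(_ _ _ (mulr_gt0 t0 a0) (mulr_gt0 t0 b0)).
  by rewrite !mulKf ?gt_eqF// => <-//; rewrite invf_ge1.
apply/eqP; rewrite eq_le density_function_scale_le//=.
have := density_function_scale_le (density_functionC dk) t1 a0 b0; lra.
Qed.

(** The supremum of k is nearly attained near some diagonal point, and k takes
    the value k 1 1 on the whole diagonal by scale invariance. *)
Lemma density_function_le11 k a b : density_function k -> 0 < a -> 0 < b ->
  k a b <= k 1 1.
Proof.
move=> dk a0 b0; have [hk k01 lk] := dk.
have [M supM] : exists M, quadrant_sup k M.
  by apply: (@quadrant_sup_exists _ 1) => x y x0 y0; case/andP: (k01 x y x0 y0).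
suff M0 : M <= k 1 1 by apply: le_trans (supM.1 _ _ a0 b0) _.
rewrite leNgt; apply/negP => M1.
have k110 := k01 1 1 ltr01 ltr01.
have M2 : M <= 1.
  rewrite leNgt; apply/negP => M2.
  have [|x [y [x0 y0]]] := supM.2 (M - 1); first by lra.
  by have := k01 _ _ x0 y0; lra.
pose e := (M - k 1 1) / 5; have e0 : 0 < e by rewrite /e; lra.
have e1 : 0 <= e <= 1 by rewrite /e; lra.
have [s s0 /(_ s)] := near_sup_diagonal hk supM (lexx 1) e0.
rewrite mul1r lexx => -[//|p [q [pl ql Mpq]]].
have := lk _ _ p q e s0 s0 e1 pl ql.
have := density_function_scale dk s0 ltr01 ltr01; rewrite mulr1 => ->.
move: Mpq; rewrite ler_norml /e; lra.
Qed.

Theorem density_function_cst k a b : density_function k -> 0 < a -> 0 < b ->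
  k a b = k 1 1.
Proof.
move=> dk a0 b0; apply/eqP; rewrite eq_le density_function_le11//=.
have := density_function_le11 (density_functionC dk) a0 b0; lra.
Qed.

End liouville.

(** * Generalities on measures *)

Lemma measurable_preimageT d1 d2 (T1 : measurableType d1)
    (T2 : measurableType d2) (f : T1 -> T2) E :
  measurable_fun setT f -> measurable E -> measurable (f @^-1` E).
Proof. by move=> mf mE; rewrite -[X in measurable X]setTI; exact: mf. Qed.

Lemma measurable_set_bool d (T : measurableType d) (f : T -> bool) :
  measurable_fun setT f -> measurable [set x | f x].
Proof.
move=> mf; rewrite (_ : [set x | f x] = setT `&` f @^-1` [set true]).
  exact: mf.
by rewrite setTI.
Qed.

Lemma product_measure12E d1 d2 (T1 : measurableType d1) (T2 : measurableType d2)
  (R : realType) (m1 : {sigma_finite_measure set T1 -> \bar R})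
  (m2 : {sigma_finite_measure set T2 -> \bar R}) (E : set (T1 * T2)) :
  measurable E -> (m1 \x m2)%E E = (\int[m2]_y m1 (ysection E y))%E.
Proof.
move=> mE; apply: (@product_measure_unique _ _ _ _ _ _ _ (m1 \x^ m2)%E) => //.
by move=> A B mA mB /=; rewrite product_measure2E.
Qed.

(** The push-forward with its structure of measure, for a map whose
    measurability is given by a proof and not by its type. *)
Definition image_measure d1 d2 (T1 : measurableType d1)
    (T2 : measurableType d2) (R : realType) (m : {measure set T1 -> \bar R})
    (f : T1 -> T2) (mf : measurable_fun setT f) :
    {measure set T2 -> \bar R} :=
  measure_function_pushforward__canonical__measure_function_Measure m mf.

Section translation.
Variable R : realType.
Local Notation leb := (@lebesgue_measure R).

Let measurable_addl (c : R) :
  @measurable_fun _ _ (measurableTypeR R) (measurableTypeR R) setT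
    (fun x : R => c + x).
Proof. by apply: measurable_funD. Qed.

Lemma lebesgue_measure_translate (c : R) (S : set (measurableTypeR R)) :
  measurable S -> leb [set x : R | S (c + x)] = leb S.
Proof.
move=> mS; apply/esym.
apply: (@lebesgue_measure_unique R (image_measure leb (measurable_addl c))) => //.
move=> _ [[a b] _ <-] /=; rewrite /pushforward.
rewrite (_ : _ @^-1` _ = `]a - c, b - c]%classic); last first.
  by apply/seteqP; split => x /=; rewrite !in_itv/= ltrBlDl lerBrDl.
by rewrite !lebesgue_measure_itv/= !lte_fin ltrD2r -!EFinB opprB addrA subrK.
Qed.
End translation.

(** * Shears and triangles in the plane *)

Section plane.
Variable R : realType.
Local Notation leb := (@lebesgue_measure R).
Local Notation line := (measurableTypeR R).
Local Notation plane := (line * line)%type.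
Local Notation area := (@lebesgue_measure R \x @lebesgue_measure R)%E.

Definition shear1 (p : plane) : plane := (p.1 + p.2, p.2).
Definition shear2 (p : plane) : plane := (p.1, p.1 + p.2).

Lemma measurable_shear1 : measurable_fun setT shear1.
Proof.
apply: measurable_fun_pair; last exact: measurable_snd.
exact: (measurable_funD measurable_fst measurable_snd).
Qed.

Lemma area_shear1 E : measurable E -> area (shear1 @^-1` E) = area E.
Proof.
move=> mE; rewrite !product_measure12E//; 
  last exact: measurable_preimageT measurable_shear1 mE.
apply: eq_integral => y _ /=.
rewrite -(lebesgue_measure_translate y (measurable_ysection y mE)).
by congr (leb _); apply/seteqP; split => x; rewrite /= !ysectionP /shear1 /= addrC.
Qed.

Lemma area_shear2 E : measurable E -> area (shear2 @^-1` E) = area E.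
Proof.
move=> mE; apply: eq_integral => x _ /=.
rewrite -(lebesgue_measure_translate x (measurable_xsection x mE)).
by congr (leb _); apply/seteqP; split => y; rewrite /= !xsectionP.
Qed.

Lemma measurable_ltp (f g : plane -> line) : measurable_fun setT f ->
  measurable_fun setT g -> measurable [set p | f p < g p].
Proof.
by move=> mf mg; apply: measurable_set_bool; exact: measurable_fun_ltr.
Qed.

Lemma measurable_below : measurable [set p : plane | p.2 < p.1].
Proof. exact: measurable_ltp measurable_snd measurable_fst. Qed.

Lemma measurable_above : measurable [set p : plane | p.1 < p.2].
Proof. exact: measurable_ltp measurable_fst measurable_snd. Qed.

Lemma measurable_diag : measurable [set p : plane | p.1 == p.2].
Proof.
apply: measurable_set_bool; apply: measurable_fun_eqr.
  exact: measurable_fst.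
exact: measurable_snd.
Qed.

Lemma area_diag E : measurable E -> area (E `&` [set p | p.1 == p.2]) = 0%E.
Proof.
move=> mE; apply: integral0_eq => x _ /=; apply/eqP.
have mED : measurable (E `&` [set p : plane | p.1 == p.2]).
  by apply: measurableI => //; exact: measurable_diag.
rewrite -measure_le0 -(lebesgue_measure_set1 x).
apply: le_measure; rewrite ?inE//=; first exact: measurable_xsection.
by move=> y; rewrite xsectionP => -[_ /= /eqP ->].
Qed.

(** The geometric form of one step of Euclid's algorithm: each half of the
    complement of the diagonal is pulled back by the shear that maps the
    quadrant onto the corresponding half of the quadrant. *)
Lemma area_split E : measurable E ->
  area E = (area (shear1 @^-1` (E `&` [set p | (p.2 < p.1)%R])) +
            area (shear2 @^-1` (E `&` [set p | (p.1 < p.2)%R])))%E.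
Proof.
move=> mE.
have mb : measurable (E `&` [set p | (p.2 < p.1)%R]).
  by apply: measurableI => //; exact: measurable_below.
have ma : measurable (E `&` [set p | (p.1 < p.2)%R]).
  by apply: measurableI => //; exact: measurable_above.
have md : measurable (E `&` [set p | (p.1 == p.2)%R]).
  by apply: measurableI => //; exact: measurable_diag.
rewrite area_shear1// area_shear2// -measureU//; last first.
  by apply/seteqP; split => // p [[_ /= /lt_trans h] [_ /= /h]]; rewrite ltxx.
rewrite -[RHS]adde0 -(area_diag mE) -measureU//; last 2 first.
- exact: measurableU.
- apply/seteqP; split => // p [[|] [_ /= h] [_ /= /eqP e]].
    by rewrite e ltxx in h.
  by rewrite e ltxx in h.
congr area; apply/seteqP; split => p; last by case=> [[]|] [].
move=> Ep; case: (ltgtP p.1 p.2) => h; [left;right|left;left|right] => //.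
by split => //=; apply/eqP.
Qed.

Definition quadrant : set plane := [set p | 0 < p.1 /\ 0 < p.2].

(** The open triangle with vertices 0, (1/a, 0) and (0, 1/b). *)
Definition triangle (a b : R) : set plane :=
  quadrant `&` [set p | a * p.1 + b * p.2 < 1].

Lemma measurable_quadrant : measurable quadrant.
Proof.
rewrite (_ : quadrant = [set p | 0 < p.1] `&` [set p | 0 < p.2])//.
apply: measurableI; apply: measurable_ltp => //.
Qed.

Lemma measurable_linear (a b : R) :
  measurable_fun setT (fun p : plane => a * p.1 + b * p.2 : line).
Proof.
apply: measurable_funD; apply: measurable_funM => //.
Qed.

Lemma measurable_triangle a b : measurable (triangle a b).
Proof.
apply: measurableI; first exact: measurable_quadrant.
by apply: measurable_ltp => //; exact: measurable_linear.
Qed.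

Lemma area_le_xsection (E F : set plane) : measurable E -> measurable F ->
  (forall x, leb (xsection E x) <= leb (xsection F x))%E ->
  (area E <= area F)%E.
Proof.
move=> mE mF EF; apply: ge0_le_integral => //.
- exact: measurable_fun_xsection.
- exact: measurable_fun_xsection.
- by move=> x _; exact: EF.
Qed.

Lemma area_box (a b : R) : 0 < a -> 0 < b ->
  area (`]0, a[ `*` `]0, b[) = (a * b)%:E.
Proof.
move=> a0 b0; rewrite product_measure1E//= !lebesgue_measure_itv/= !lte_fin a0 b0.
by rewrite !sube0 EFinM.
Qed.

Lemma area_triangle_le a b : 0 < a -> 0 < b ->
  (area (triangle a b) <= (a^-1 * b^-1)%:E)%E.
Proof.
move=> a0 b0; rewrite -area_box ?invr_gt0//.
apply: le_measure; rewrite ?inE; [exact: measurable_triangle| |].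
  exact: measurableX.
move=> [x y] [[/= x0 y0] xy]; split; rewrite /= in_itv/=.
  by rewrite x0/= -div1r ltr_pdivlMr//; nra.
by rewrite y0/= -div1r ltr_pdivlMr//; nra.
Qed.

(** The sliver lies over ]0, 1/a[, and its vertical sections are contained in
    intervals of length at most e / b, because a x + b y varies there between
    1 / (1 + e) and 1. *)
Lemma area_sliver_le a b a' b' e : 0 < a -> 0 < b -> 0 < e ->
  a <= a' <= (1 + e) * a -> b <= b' <= (1 + e) * b ->
  (area (triangle a b `\` triangle a' b') <= (a^-1 * (b^-1 * e))%:E)%E.
Proof.
move=> a0 b0 e0 /andP[_ aa] /andP[_ bb].
rewrite -area_box ?mulr_gt0 ?invr_gt0//.
have mE : measurable (triangle a b `\` triangle a' b').
  by apply: measurableD; exact: measurable_triangle.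
apply: area_le_xsection => //; first exact: measurableX.
move=> x; have [xa|xa] := boolP (x \in `]0, a^-1[).
  rewrite in_xsectionX ?mem_setE// lebesgue_measure_itv/= lte_fin.
  rewrite mulr_gt0 ?invr_gt0// sube0.
  pose l := ((1 + e)^-1 - a * x) / b; pose u := (1 - a * x) / b.
  have lu : l <= u.
    by rewrite ler_pM2r ?invr_gt0// lerD2r invf_le1//; lra.
  apply: (@le_trans _ _ (leb `[l, u])).
    apply: le_measure; rewrite ?inE//; first exact: measurable_xsection.
    move=> y; rewrite xsectionP => -[[[/= x0 y0] xy] nT].
    rewrite /= in_itv/= /l /u ler_pdivrMr// ler_pdivlMr//.
    apply/andP; split; last lra.
    rewrite leNgt; apply/negP => h; apply: nT; split => //=.
    suff : (1 + e) * (a * x + b * y) < 1 by nra.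
    by rewrite mulrC -ltr_pdivlMr ?div1r; lra.
  rewrite lebesgue_measure_itv/= lte_fin; case: ifPn => _.
    rewrite -EFinB lee_fin /u /l -mulrBl mulrC ler_pM2l ?invr_gt0//.
    rewrite opprB addrA subrK lerBlDr.
    have : (1 + e)^-1 * (1 + e) = 1 by rewrite mulVf// gt_eqF//; lra.
    have : 0 < (1 + e)^-1 by rewrite invr_gt0; lra.
    nra.
  by rewrite lee_fin mulr_ge0 ?invr_ge0// ltW.
rewrite notin_xsectionX ?mem_setE//; rewrite (_ : xsection _ _ = set0) ?measure0//.
apply/seteqP; split => // y; rewrite xsectionP => -[[[/= x0 y0] xy] _].
move/negP: xa; apply; rewrite in_itv/= x0/= -div1r ltr_pdivlMr//; nra.
Qed.

Lemma shear1_triangle a b :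
  shear1 @^-1` (triangle a b `&` [set p | p.2 < p.1]) = triangle a (a + b).
Proof.
apply/seteqP; split => -[x y].
  by move=> [[[/= x0 y0] xy] yx]; split; [split|] => //=; lra.
by move=> [[/= x0 y0] xy]; split; [split; [split|]|] => //=; lra.
Qed.

Lemma shear2_triangle a b :
  shear2 @^-1` (triangle a b `&` [set p | p.1 < p.2]) = triangle (a + b) b.
Proof.
apply/seteqP; split => -[x y].
  by move=> [[[/= x0 y0] xy] yx]; split; [split|] => //=; lra.
by move=> [[/= x0 y0] xy]; split; [split; [split|]|] => //=; lra.
Qed.

(** * Proportion of an invariant set in triangles and cones *)

(** As the triangle has area 1 / (2 a b), this is half the proportion of it that
    B occupies. *)
Definition density (B : set plane) (a b : R) : R :=
  a * b * fine (area (B `&` triangle a b)).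

Lemma area_triangleI_fin B a b : measurable B -> 0 < a -> 0 < b ->
  area (B `&` triangle a b) \is a fin_num.
Proof.
move=> mB a0 b0; rewrite ge0_fin_numE//.
apply: (@le_lt_trans _ _ (a^-1 * b^-1)%:E); last exact: ltry.
apply: le_trans (area_triangle_le a0 b0).
apply: le_measure; rewrite ?inE; last exact: subIsetr.
- by apply: measurableI => //; exact: measurable_triangle.
- exact: measurable_triangle.
Qed.

Section invariant.
Variable B : set plane.
Hypotheses (mB : measurable B) (B1 : shear1 @^-1` B = B)
  (B2 : shear2 @^-1` B = B).

Lemma area_invariant_split E : measurable E ->
  area (B `&` E) =
    (area (B `&` shear1 @^-1` (E `&` [set p | (p.2 < p.1)%R])) +
     area (B `&` shear2 @^-1` (E `&` [set p | (p.1 < p.2)%R])))%E.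
Proof.
move=> mE; rewrite (area_split (measurableI _ _ mB mE)).
suff BI f S : f @^-1` B = B -> f @^-1` (B `&` E `&` S) = B `&` f @^-1` (E `&` S).
  by rewrite (BI shear1)// (BI shear2).
by move=> fB; rewrite -setIA preimage_setI fB.
Qed.

(** Harmonicity is the invariance of B under the shears; the bounds and the slow
    variation come from the areas of triangles and of slivers. *)
Lemma density_is_density_function : density_function (density B).
Proof.
have mT a b : measurable (B `&` triangle a b).
  by apply: measurableI => //; exact: measurable_triangle.
have [h hE] : exists h, forall a b, 0 < a -> 0 < b ->
    area (B `&` triangle a b) = (h a b)%:E.
  exists (fun a b => fine (area (B `&` triangle a b))) => a b a0 b0.
  by rewrite fineK// area_triangleI_fin.
have dE a b : 0 < a -> 0 < b -> density B a b = a * b * h a b.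
  by move=> a0 b0; rewrite /density hE.
have h0 a b : 0 < a -> 0 < b -> 0 <= h a b.
  by move=> a0 b0; rewrite -lee_fin -hE.
have h1 a b : 0 < a -> 0 < b -> h a b <= a^-1 * b^-1.
  move=> a0 b0; rewrite -lee_fin -hE//.
  apply: le_trans (area_triangle_le a0 b0).
  by apply: le_measure; rewrite ?inE//; exact: measurable_triangle.
have hsplit a b : 0 < a -> 0 < b -> h a b = h a (a + b) + h (a + b) b.
  move=> a0 b0; have ab0 : 0 < a + b by rewrite addr_gt0.
  have := area_invariant_split (measurable_triangle a b).
  by rewrite shear1_triangle shear2_triangle !hE// => -[].
have hsliver a b a' b' e : 0 < a -> 0 < b -> 0 < e ->
    a <= a' <= (1 + e) * a -> b <= b' <= (1 + e) * b ->
    h a' b' <= h a b <= h a' b' + a^-1 * (b^-1 * e).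
  move=> a0 b0 e0 aa bb; have a'0 : 0 < a' by lra.
  have b'0 : 0 < b' by lra.
  have TT : triangle a' b' `<=` triangle a b.
    by move=> [x y] [[/= x0 y0] xy]; split; [split|] => //=; nra.
  rewrite -!lee_fin EFinD -!hE//; apply/andP; split.
    by apply: le_measure; rewrite ?inE//; exact: setIS.
  apply: le_trans (leeD2l _ (area_sliver_le a0 b0 e0 aa bb)).
  have mD : measurable (triangle a b `\` triangle a' b').
    by apply: measurableD; exact: measurable_triangle.
  apply: le_trans (measureU2 _ _ _) => //.
  apply: le_measure; rewrite ?inE//; first exact: measurableU.
  move=> p [Bp Tp]; have [T'p|T'p] := pselect (triangle a' b' p).
    by left.
  by right.
have d01 a b : 0 < a -> 0 < b -> 0 <= a * b * h a b <= 1.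
  move=> a0 b0; have ab0 : 0 < a * b by rewrite mulr_gt0.
  rewrite mulr_ge0 ?(ltW ab0) ?h0//=.
  rewrite (_ : 1 = a * b * (a^-1 * b^-1)); first by rewrite ler_pM2l ?h1.
  by field; rewrite !gt_eqF.
split=> [a b a0 b0|a b a0 b0|a b a' b' e a0 b0 /andP[]].
- by rewrite !dE ?addr_gt0// hsplit//; ring.
- by rewrite dE ?d01.
rewrite le_eqVlt => /predU1P[<- _|e0 e1 aa bb].
  by rewrite addr0 !mul1r -!eq_le => /eqP <- /eqP <-; rewrite subrr normr0 mulr0.
have a'0 : 0 < a' by lra.
have b'0 : 0 < b' by lra.
rewrite !dE//; have /andP[hge hle] := hsliver _ _ _ _ _ a0 b0 e0 aa bb.
move: (d01 a b a0 b0) hle hge (h0 a b a0 b0) (h0 a' b' a'0 b'0).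
move: (h a b) (h a' b') => {h hE dE h0 h1 hsplit hsliver d01}.
move=> h h' d1 hle hge hh hh'.
have e2 : a * b * h <= a * b * h' + e.
  rewrite (_ : e = a * b * (a^-1 * (b^-1 * e))); last first.
    by field; rewrite !gt_eqF.
  by rewrite -mulrDr ler_pM2l ?mulr_gt0.
have e3 : a * b <= a' * b' by apply: ler_pM; lra.
have e4 : a' * b' <= (1 + 3 * e) * (a * b).
  apply: (@le_trans _ _ (((1 + e) * a) * ((1 + e) * b))).
    by apply: ler_pM; lra.
  rewrite mulrACA; apply: ler_wpM2r; first by rewrite mulr_ge0// ltW.
  nra.
have e5 : a * b * h' <= a' * b' * h' by apply: ler_wpM2r.
have e6 : a' * b' * h' <= (1 + 3 * e) * (a * b) * h.
  by apply: ler_pM => //; apply: mulr_ge0; exact: ltW.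
rewrite ler_norml; apply/andP; split; first lra.
rewrite -mulrA in e6; nra.
Qed.

(** All the triangles are part of the notion because a shear changes their
    parameters (a, b). *)
Definition proportional (r : R) (E : set plane) := forall a b, 0 < a -> 0 < b ->
  area (B `&` (E `&` triangle a b)) = (r%:E * area (E `&` triangle a b))%E.

Lemma proportional_quadrant r E F : (forall p, quadrant p -> E p <-> F p) ->
  proportional r E -> proportional r F.
Proof.
move=> EF rE a b a0 b0; have <- : E `&` triangle a b = F `&` triangle a b.
  by apply/seteqP; split => p [Ep Tp]; split=> //; apply/(EF p Tp.1).
exact: rE.
Qed.

Lemma proportional_set0 r : proportional r set0.
Proof. by move=> a b _ _; rewrite set0I setI0 measure0 mule0. Qed.

End invariant.

(** The densities of B and of the plane are constant functions, and r is their
    quotient. *)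
Lemma proportional_setT B : measurable B -> shear1 @^-1` B = B ->
  shear2 @^-1` B = B -> exists2 r, 0 <= r & proportional B r setT.
Proof.
move=> mB B1 B2.
have dB := density_is_density_function mB B1 B2.
have dT : density_function (density setT).
  by apply: density_is_density_function => //; rewrite preimage_setT.
have c0 : 0 < density setT 1 1.
  rewrite /density !mul1r setTI.
  have fT : area (triangle 1 1) \is a fin_num.
    by rewrite -[X in area X]setTI area_triangleI_fin.
  rewrite -lte_fin fineK//.
  pose d : R := 2^-1; have d0 : 0 < d by rewrite invr_gt0.
  have dd : d + d = 1 by rewrite /d; lra.
  have : (area (`]0%R, d[ `*` `]0%R, d[) <= area (triangle 1 1))%E.
    apply: le_measure; rewrite ?inE; first exact: measurableX.
      exact: measurable_triangle.
    move=> [x y] [/=]; rewrite !in_itv/= => /andP[x0 x1] /andP[y0 y1].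
    by split; [split|] => //=; lra.
  by apply: lt_le_trans; rewrite area_box// lte_fin mulr_gt0.
exists (density B 1 1 / density setT 1 1).
  by rewrite divr_ge0 ?(ltW c0)//; case/andP: (df_bounds dB ltr01 ltr01).
move=> a b a0 b0; rewrite setTI.
have := density_function_cst dB a0 b0; have := density_function_cst dT a0 b0.
move: c0; move: (density B 1 1) (density setT 1 1) => r1 r2 r20.
rewrite /density setTI => e2 e1.
have fB := area_triangleI_fin mB a0 b0.
have fT := area_triangleI_fin measurableT a0 b0; rewrite setTI in fT.
rewrite -(fineK fB) -(fineK fT) -EFinM; congr _%:E.
have ab0 : a * b != 0 by rewrite gt_eqF// mulr_gt0.
apply: (mulfI ab0); rewrite mulrCA e1 e2 divfK// gt_eqF//.
Qed.

Section cones.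
Variable B : set plane.
Hypotheses (mB : measurable B) (B1 : shear1 @^-1` B = B)
  (B2 : shear2 @^-1` B = B).

(** The shears pull the two halves of E cut by the diagonal back to E1 and E2,
    and areas add up. *)
Lemma proportional_shear r E E1 E2 : 0 <= r -> measurable E ->
  (forall p, quadrant p -> E (shear1 p) <-> E1 p) ->
  (forall p, quadrant p -> E (shear2 p) <-> E2 p) ->
  proportional B r E1 -> proportional B r E2 -> proportional B r E.
Proof.
move=> r0 mE h1 h2 r1 r2 a b a0 b0.
have mET : measurable (E `&` triangle a b).
  by apply: measurableI => //; exact: measurable_triangle.
have e1 : shear1 @^-1` (E `&` triangle a b `&` [set p | p.2 < p.1]) =
    E1 `&` triangle a (a + b).
  rewrite -setIA preimage_setI shear1_triangle.
  by apply/seteqP; split => p [Ep Tp]; split=> //; apply/(h1 p Tp.1).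
have e2 : shear2 @^-1` (E `&` triangle a b `&` [set p | p.1 < p.2]) =
    E2 `&` triangle (a + b) b.
  rewrite -setIA preimage_setI shear2_triangle.
  by apply/seteqP; split => p [Ep Tp]; split=> //; apply/(h2 p Tp.1).
rewrite area_invariant_split// (area_split mET) e1 e2 ge0_muleDr//.
by rewrite r1 ?r2 ?addr_gt0.
Qed.

Definition cone (p q : nat) : set plane := [set z | q%:R * z.1 < p%:R * z.2].

Lemma measurable_cone p q : measurable (cone p q).
Proof. by apply: measurable_ltp; apply: measurable_funM. Qed.

(** Euclid's algorithm on (p, q): if q <= p, the shears pull the cone back to
    the cone of (p - q, q) and to the quadrant; if p <= q, to the empty set and
    to the cone of (p, q - p). When p = q both descriptions hold, one of the
    cones being empty and the other the quadrant. *)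
Lemma proportional_cone r p q : 0 <= r -> proportional B r setT ->
  proportional B r (cone p q).
Proof.
move=> r0 rT.
have [n] := ubnP (p + q)%N; elim: n => // n IHn in p q * => pqn.
have [->|p0] := posnP p.
  apply: (@proportional_quadrant _ _ set0); last exact: proportional_set0.
  move=> [x y] [/= x0 y0]; split => //; rewrite /cone /= mul0r => h.
  by have : 0 <= q%:R * x; [rewrite mulr_ge0// ltW|lra].
have [->|q0] := posnP q.
  apply: (@proportional_quadrant _ _ setT) => // -[x y] [/= x0 y0]; split => // _.
  by rewrite /cone /= mul0r mulr_gt0// ltr0n.
have px (x : R) : 0 < x -> 0 < p%:R * x by move=> x0; rewrite mulr_gt0// ltr0n.
have qx (x : R) : 0 < x -> 0 < q%:R * x by move=> x0; rewrite mulr_gt0// ltr0n.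
apply: (@proportional_shear _ _ (if (q <= p)%N then cone (p - q) q else set0)
  (if (p <= q)%N then cone p (q - p) else setT)) => //.
- exact: measurable_cone.
- move=> [x y] [/= x0 y0]; rewrite /cone /=; case: leqP => qp /=.
    by rewrite natrB// mulrBl mulrDr; split; lra.
  split => //; have : (p%:R * y <= q%:R * y :> R).
    by rewrite ler_pM2r// ler_nat ltnW.
  have := qx x x0; lra.
- move=> [x y] [/= x0 y0]; rewrite /cone /=; case: leqP => pq /=.
    by rewrite natrB// mulrBl mulrDr; split; lra.
  split => // _; have : (q%:R * x <= p%:R * x :> R).
    by rewrite ler_pM2r// ler_nat ltnW.
  have := px y y0; lra.
- case: leqP => qp; last exact: proportional_set0.
  by apply: IHn; lia.
- case: leqP => pq //.
  by apply: IHn; lia.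
Qed.

End cones.

(** * From cones to Borel sets *)

Definition rational_ray : set (set line) :=
  [set X | X = setT \/ exists q : rat, X = `]-oo, ratr q[%classic].

Definition ray : set (set line) :=
  [set X | X = setT \/ exists s : R, X = `]-oo, s[%classic].

(** In the coordinates (x / (x + y), x + y), a truncated cone of rational slope
    is a product of two rays. The full line is included among the rays so that
    the whole plane belongs to the pi-system. *)
Definition corners : set (set plane) :=
  [set X `*` Y | X in rational_ray & Y in ray].

Lemma rayI (a b : R) :
  `]-oo, a[%classic `&` `]-oo, b[%classic =
  `]-oo, (if a <= b then a else b)[%classic :> set R.
Proof.
have [ab|ab] := leP a b; apply/seteqP; split => x /=; rewrite !in_itv/=.
- by case.
- by move=> xa; split => //; lra.
- by case.
- by move=> xb; split => //; lra.
Qed.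

Lemma setI_closed_corners : setI_closed corners.
Proof.
move=> _ _ [X1 hX1 [Y1 hY1 <-]] [X2 hX2 [Y2 hY2 <-]].
rewrite -setXI; exists (X1 `&` X2); last exists (Y1 `&` Y2) => //.
  case: hX1 => [->|[q1 ->]]; first by rewrite setTI.
  case: hX2 => [->|[q2 ->]]; first by rewrite setIT; right; exists q1.
  by right; exists (if q1 <= q2 then q1 else q2); rewrite rayI ler_rat; case: ifP.
case: hY1 => [->|[q1 ->]]; first by rewrite setTI.
case: hY2 => [->|[q2 ->]]; first by rewrite setIT; right; exists q1.
by right; rewrite rayI; eexists.
Qed.

Lemma measurable_corners : @measurable _ plane = <<s corners >>.
Proof.
apply/seteqP; split; last first.
  apply: smallest_sub; first exact: sigma_algebra_measurable.
  move=> _ [X hX [Y hY <-]]; apply: measurableX.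
    by case: hX => [->|[q ->]] //; exact: measurable_itv.
  by case: hY => [->|[q ->]] //; exact: measurable_itv.
pose GT := g_sigma_algebraType corners.
have mfst : @measurable_fun _ _ GT line setT fst.
  apply: (@measurability _ _ _ _ _ _ _).
    exact: RGenInftyO.measurableE.
  move=> _ [_ [x ->] <-].
  rewrite setTI (_ : fst @^-1` _ = \bigcup_(q : rat)
     (if ratr q < x then `]-oo, ratr q[%classic `*` setT else set0)).
    apply: bigcupT_measurable_rat => q; case: ifP => // _.
    apply: sub_sigma_algebra; exists `]-oo, ratr q[%classic.
      by right; exists q.
    by exists setT => //; left.
  apply/seteqP; split => [[u v] /=|[u v] [q _]].
    rewrite in_itv/= => ux.
    have [q] := rat_in_itvoo ux; rewrite in_itv/= => /andP[uq qx].
    by exists q => //; rewrite qx; split => //=; rewrite in_itv.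
  by case: ifP => // qx [/= + _]; rewrite !in_itv/= => /lt_trans; exact.
have msnd : @measurable_fun _ _ GT line setT snd.
  apply: (@measurability _ _ _ _ _ _ _).
    exact: RGenInftyO.measurableE.
  move=> _ [_ [x ->] <-].
  rewrite setTI; apply: sub_sigma_algebra; exists setT; first by left.
  exists `]-oo, x[%classic; first by right; exists x.
  by apply/seteqP; split => // p [].
apply: smallest_sub; first exact: smallest_sigma_algebra.
by move=> _ [] [X mX <-]; [exact: mfst|exact: msnd].
Qed.

Lemma ratr_fraction (q : rat) : 0 < q < 1 ->
  exists n d : nat, (n <= d)%N /\ (0 < d)%N /\ ratr q = n%:R / d%:R :> R.
Proof.
move=> /andP[q0 q1].
have nE : numq q = `|numq q|%N by rewrite gez0_abs// numq_ge0 ltW.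
have dE : denq q = `|denq q|%N by rewrite gez0_abs.
exists `|numq q|%N, `|denq q|%N; split; last split.
- rewrite -lez_nat -nE -dE.
  move: q1; rewrite -{1}(divq_num_den q) ltr_pdivrMr ?ltr0z//.
  by rewrite mul1r ltr_int => /ltW.
- by rewrite absz_gt0.
- by rewrite /ratr {1}nE {1}dE -!pmulrn.
Qed.

(** The power of exponent -1 is a measurable function that agrees with the
    inverse where x + y is positive. *)
Definition coords (p : plane) : plane :=
  (p.1 * (p.1 + p.2) `^ (-1), p.1 + p.2).

Definition uncoords (q : plane) : plane := (q.1 * q.2, q.2 - q.1 * q.2).

Lemma coordsK p : 0 < p.1 + p.2 -> uncoords (coords p) = p.
Proof.
case: p => x y /= xy0; rewrite /uncoords /coords /= powR_inv1 ?(ltW xy0)//.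
by rewrite divfK ?gt_eqF// addrAC subrr add0r.
Qed.

Lemma measurable_coords : measurable_fun setT coords.
Proof.
have ms : measurable_fun setT (fun p : plane => p.1 + p.2 : line).
  by apply: measurable_funD.
apply: measurable_fun_pair => //; apply: measurable_funM => //.
exact: (measurableT_comp (measurable_powR (-1))).
Qed.

Lemma measurable_uncoords : measurable_fun setT uncoords.
Proof.
have ms : measurable_fun setT (fun p : plane => p.1 * p.2 : line).
  by apply: measurable_funM.
by apply: measurable_fun_pair => //; apply: measurable_funB.
Qed.

Section invariant.
Variable B : set plane.
Hypotheses (mB : measurable B) (B1 : shear1 @^-1` B = B)
  (B2 : shear2 @^-1` B = B).

Lemma proportional_rational_ray r X : 0 <= r -> proportional B r setT ->
  rational_ray X -> proportional B r [set p | X (coords p).1].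
Proof.
move=> r0 rT [->|[q ->]]; first exact: rT.
have s0 (p : plane) : quadrant p -> 0 < p.1 + p.2.
  by case=> x0 y0; rewrite addr_gt0.
have cE (p : plane) : quadrant p ->
    p.1 * (p.1 + p.2) `^ (-1) = p.1 / (p.1 + p.2).
  by move=> /s0 p0; rewrite powR_inv1// ltW.
have [q0|q0] := leP q 0.
  apply: (@proportional_quadrant _ _ set0); last exact: proportional_set0.
  move=> p Qp; split => //; rewrite /= in_itv/= cE// => h.
  have : (ratr q : R) <= 0 by rewrite lerq0.
  rewrite leNgt (lt_trans _ h)// divr_gt0 ?s0//; exact: Qp.1.
have [q1|q1] := leP 1 q.
  apply: (@proportional_quadrant _ _ setT) => //.
  move=> p Qp; split => // _; rewrite /= in_itv/= cE//.
  apply: (@lt_le_trans _ _ 1); last by rewrite -(rmorph1 (@ratr R)) ler_rat.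
  by rewrite ltr_pdivrMr ?s0// mul1r ltrDl; exact: Qp.2.
have [|n [d [nd [d0 qE]]]] := @ratr_fraction q; first by rewrite q0.
apply: (@proportional_quadrant _ _ (cone n (d - n)));
  last exact: proportional_cone.
move=> p Qp; rewrite /cone /= in_itv/= cE// qE natrB//.
rewrite ltr_pdivrMr ?s0// mulrAC ltr_pdivlMr ?ltr0n//.
by split; nra.
Qed.

(** Among the triangles c x + c y < 1, a truncation by x + y < s is again a
    triangle, which brings the truncated cones under the scope of
    proportionality. *)
Lemma triangle_strip (c s : R) : 0 < c -> 0 < s ->
  triangle c c `&` [set p | p.1 + p.2 < s] =
  triangle (Num.max c s^-1) (Num.max c s^-1).
Proof.
move=> c0 s0; have sE x y : (s^-1 * x + s^-1 * y < 1) = (x + y < s).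
  by rewrite -mulrDr mulrC ltr_pdivrMr// mul1r.
apply/seteqP; split => -[x y].
  move=> [[[/= x0 y0] /= xy] /= xys]; split; [split|] => //=.
  by case: (leP c s^-1); rewrite ?sE.
move=> [[/= x0 y0]]; case: (leP c s^-1) => [cs|/ltW sc]; rewrite ?sE => xy.
  split=> //; split=> //=; move: xy; rewrite -sE; apply: le_lt_trans.
  by apply: lerD; apply: ler_wpM2r => //; exact: ltW.
split; first by split.
rewrite /= -sE; move: xy; apply: le_lt_trans.
by apply: lerD; apply: ler_wpM2r => //; exact: ltW.
Qed.

Lemma area_corners r c S : 0 <= r -> 0 < c -> proportional B r setT ->
  corners S ->
  area (coords @^-1` S `&` (B `&` triangle c c)) =
  (r%:E * area (coords @^-1` S `&` triangle c c))%E.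
Proof.
move=> r0 c0 rT [X hX [Y hY <-]].
have rX := proportional_rational_ray r0 rT hX.
set E := [set p | X (coords p).1] in rX.
have -> : coords @^-1` (X `*` Y) = E `&` [set p | Y (coords p).2].
  by apply/seteqP; split.
rewrite [_ `&` (B `&` _)]setICA -[_ `&` triangle c c]setIA.
case: hY => [->|[s ->]].
  have -> : [set p : plane | setT (coords p).2] = setT by apply/seteqP; split.
  by rewrite setTI; exact: rX.
have -> : [set p : plane | `]-oo, s[%classic (coords p).2] =
    [set p | p.1 + p.2 < s].
  by apply/seteqP; split => p; rewrite /= in_itv.
rewrite [_ `&` triangle c c]setIC.
have [s0|s0] := leP s 0; last first.
  rewrite triangle_strip//; apply: rX; rewrite lt_max c0//.
rewrite (_ : triangle c c `&` _ = set0) ?setI0 ?measure0 ?mule0//.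
by apply/seteqP; split => // -[x y] [[[/= x0 y0] _]]; rewrite /=; lra.
Qed.

(** Uniqueness of measures: the measures r area and area restricted to B, both
    restricted to a triangle and transported by the coordinates, agree on the
    pi-system of corners. *)
Lemma area_triangle_proportional r c (E : set plane) : 0 <= r -> 0 < c ->
  proportional B r setT -> measurable E ->
  area (E `&` (B `&` triangle c c)) = (r%:E * area (E `&` triangle c c))%E.
Proof.
move=> r0 c0 rT mE.
have mT := measurable_triangle c c.
have mBT : measurable (B `&` triangle c c) by exact: measurableI.
pose m1 := image_measure (mrestr area mBT) measurable_coords.
pose m2 := mscale (NngNum r0) (image_measure (mrestr area mT) measurable_coords).
have mm : forall A, measurable A -> m1 A = m2 A.
  move=> A; apply: (measure_unique corners (fun=> setT)).
  - exact: measurable_corners.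
  - exact: setI_closed_corners.
  - by move=> _; exists setT; [left|exists setT; [left|rewrite setXTT]].
  - by rewrite bigcup_const//; exists 0%N.
  - by move=> S hS; exact: area_corners.
  - move=> _; rewrite /m1 /= /pushforward /mrestr preimage_setT setTI.
    by rewrite -ge0_fin_numE// area_triangleI_fin.
have mE' : measurable (uncoords @^-1` E).
  by rewrite -[X in measurable X]setTI; exact: measurable_uncoords.
have := mm _ mE'; rewrite /m1 /m2 /mscale /= /pushforward /mrestr.
have Q0 (p : plane) : quadrant p -> 0 < p.1 + p.2.
  by case=> x0 y0; rewrite addr_gt0.
have eE (S : set plane) : S `<=` quadrant ->
    coords @^-1` (uncoords @^-1` E) `&` S = E `&` S.
  move=> SQ; apply/seteqP; split => p [/= Ep Sp]; split => //=.
    by move: Ep; rewrite coordsK//; exact/Q0/SQ.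
  by rewrite coordsK//; exact/Q0/SQ.
rewrite !eE//; first by move=> p [].
by move=> p [_ []].
Qed.
End invariant.

(** * Ergodicity of SL(2, Z) on the plane *)

Definition quarter_turn (p : plane) : plane := (- p.2, p.1).

Definition unshear1 (p : plane) : plane := (p.1 - p.2, p.2).

Lemma measurable_quarter_turn : measurable_fun setT quarter_turn.
Proof.
by apply: measurable_fun_pair => //; apply: measurable_funN.
Qed.

Lemma measurable_unshear1 : measurable_fun setT unshear1.
Proof.
by apply: measurable_fun_pair => //; apply: measurable_funB.
Qed.

Lemma unshear1K (p : plane) : unshear1 (shear1 p) = p.
Proof. by case: p => x y; rewrite /unshear1 /shear1 /= addrK. Qed.

(** Thus the quarter turn is U^-1 L U^-1 with U, L the two shears, and inherits
    from them the preservation of the area and of invariant sets. *)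
Lemma shear1_quarter_turn (p : plane) :
  shear1 (quarter_turn (shear1 p)) = shear2 p.
Proof.
by case: p => x y; rewrite /shear1 /shear2 /quarter_turn /= [- y + _]addrC addrK.
Qed.

Lemma area_quarter_turn E : measurable E -> area (quarter_turn @^-1` E) = area E.
Proof.
move=> mE; pose E' := unshear1 @^-1` E.
have mE' : measurable E' by exact: measurable_preimageT measurable_unshear1 _.
have EE' : shear1 @^-1` E' = E.
  by apply/seteqP; split => p; rewrite /E' /= unshear1K.
have mrE : measurable (quarter_turn @^-1` E).
  exact: measurable_preimageT measurable_quarter_turn _.
rewrite -(area_shear1 mrE) -[in RHS]EE' (area_shear1 mE') -(area_shear2 mE').
by congr area; apply/seteqP; split => p;
  rewrite /E' /= -shear1_quarter_turn unshear1K.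
Qed.

Lemma invariant_quarter_turn (B : set plane) : shear1 @^-1` B = B ->
  shear2 @^-1` B = B -> quarter_turn @^-1` B = B.
Proof.
move=> B1 B2.
have b1 q : B (shear1 q) <-> B q by rewrite -[in X in _ <-> X]B1.
have b2 q : B (shear2 q) <-> B q by rewrite -[in X in _ <-> X]B2.
have h p : B (quarter_turn p) <-> B p; last first.
  by apply/seteqP; split => p /=; rewrite h.
have <- : shear1 (unshear1 p) = p.
  by case: p => x y; rewrite /shear1 /unshear1 /= subrK.
by rewrite -b1 shear1_quarter_turn b2 b1.
Qed.

(** The quarter turn permutes the four open quadrants, which cover the plane up
    to the axes. *)
Lemma negligible_of_quadrant (D : set plane) : measurable D ->
  quarter_turn @^-1` D = D -> area (D `&` quadrant) = 0%E -> area D = 0%E.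
Proof.
move=> mD rD D0.
have mQ : measurable (D `&` quadrant).
  by apply: measurableI => //; exact: measurable_quadrant.
pose rQ E := quarter_turn @^-1` E.
have mr E : measurable E -> measurable (rQ E).
  exact: measurable_preimageT measurable_quarter_turn.
have axis0 : area [set p : plane | p.1 == 0] = 0%E.
  rewrite (_ : [set p | _] = [set 0] `*` setT).
    by rewrite product_measure1E//= lebesgue_measure_set1 mul0e.
  by apply/seteqP; split => p /=; [move=> /eqP ?; split|case=> -> _].
have maxis : measurable [set p : plane | p.1 == 0].
  by apply: measurable_set_bool; apply: measurable_fun_eqr.
pose F : set plane := (D `&` quadrant) `|` rQ (D `&` quadrant) `|`
  (rQ (rQ (D `&` quadrant)) `|` rQ (rQ (rQ (D `&` quadrant)))) `|`
  ([set p | p.1 == 0] `|` rQ [set p | p.1 == 0]).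
have m1 := mr _ mQ; have m2 := mr _ m1; have m3 := mr _ m2.
have ma := mr _ maxis.
have mF : measurable F by do !apply: measurableU.
have U0 (E1 E2 : set plane) : measurable E1 -> measurable E2 ->
    area E1 = 0%E -> area E2 = 0%E -> area (E1 `|` E2) = 0%E.
  move=> mE1 mE2 e1 e2; apply/eqP; rewrite -measure_le0.
  by apply: le_trans (measureU2 _ mE1 mE2) _; rewrite /= e1 e2 adde0.
have F0 : area F = 0%E.
  have r0 E : measurable E -> area E = 0%E -> area (rQ E) = 0%E.
    by move=> mE E0; rewrite area_quarter_turn.
  have z1 := r0 _ mQ D0; have z2 := r0 _ m1 z1; have z3 := r0 _ m2 z2.
  have za := r0 _ maxis axis0.
  have mU1 := measurableU _ _ mQ m1; have mU2 := measurableU _ _ m2 m3.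
  have mU := measurableU _ _ mU1 mU2; have mUa := measurableU _ _ maxis ma.
  have u1 := U0 _ _ mQ m1 D0 z1; have u2 := U0 _ _ m2 m3 z2 z3.
  exact: (U0 _ _ mU mUa (U0 _ _ mU1 mU2 u1 u2) (U0 _ _ maxis ma axis0 za)).
apply/eqP; rewrite -measure_le0 -F0; apply: le_measure; rewrite ?inE//.
have rDE p : D p -> D (quarter_turn p) by rewrite -{1}rD.
move=> [x y] Dp; have := rDE _ Dp; have := rDE _ (rDE _ Dp).
have := rDE _ (rDE _ (rDE _ Dp)).
rewrite /F /rQ /quadrant /quarter_turn /= !opprK => h3 h2 h1.
have [x0|x0|x0] := ltgtP x 0; last by right; left; apply/eqP.
  have [y0|y0|y0] := ltgtP y 0; last by right; right; rewrite y0 oppr0.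
    left; right; left; split => //; lra.
  left; right; right; split => //; lra.
have [y0|y0|y0] := ltgtP y 0; last by right; right; rewrite y0 oppr0.
  left; left; right; split => //; lra.
by left; left; left.
Qed.

Lemma negligible_quadrant (D : set plane) : measurable D ->
  (forall c, 0 < c -> area (D `&` triangle c c) = 0%E) ->
  area (D `&` quadrant) = 0%E.
Proof.
move=> mD DT; pose T n := triangle (n.+1%:R^-1 : R) n.+1%:R^-1.
have mT n : measurable (D `&` T n).
  by apply: measurableI => //; exact: measurable_triangle.
have -> : D `&` quadrant = \bigcup_n (D `&` T n).
  rewrite -setI_bigcupr; congr (_ `&` _).
  apply/seteqP; split => [[x y] [/= x0 y0]|p [n _ []]//].
  exists (Num.truncn (x + y)) => //; split => //=.
  by rewrite -mulrDr mulrC ltr_pdivrMr ?mul1r ?ltr0n// truncnS_gt.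
apply/negligibleP; first exact: bigcupT_measurable.
apply: negligible_bigcup => n; apply/negligibleP => //.
by apply: DT; rewrite invr_gt0.
Qed.

(** The two shears generate SL(2, Z). With E = B, proportionality reads
    area B = r area B in each triangle, so either r = 1 or B is null. *)
Theorem plane_ergodic (B : set plane) : measurable B ->
  shear1 @^-1` B = B -> shear2 @^-1` B = B ->
  area B = 0%E \/ area (~` B) = 0%E.
Proof.
move=> mB B1 B2; have rB := invariant_quarter_turn B1 B2.
have [r r0 rT] := proportional_setT mB B1 B2.
have mT c : measurable (triangle c c) := measurable_triangle c c.
have key c : 0 < c ->
    area (B `&` triangle c c) = (r%:E * area (B `&` triangle c c))%E.
  move=> c0; have := area_triangle_proportional mB B1 B2 r0 c0 rT mB.
  by rewrite setIA setIid.
have [r1|r1] := eqVneq r 1; [right|left].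
  have mC : measurable (~` B) by exact: measurableC.
  apply: negligible_of_quadrant => //; first by rewrite -preimage_setC rB.
  apply: negligible_quadrant => // c c0.
  have := rT _ _ c0 c0; rewrite setTI r1 mul1e => e.
  rewrite setIC -setDE measureD//.
    by rewrite /= [_ `&` B]setIC e subee// -[triangle c c]setTI area_triangleI_fin.
  by rewrite -ge0_fin_numE// -[triangle c c]setTI area_triangleI_fin.
apply: negligible_of_quadrant => //.
apply: negligible_quadrant => // c c0.
have := key c c0; have := area_triangleI_fin mB c0 c0.
move: (area _) => [a| |]// _ [] /eqP; rewrite -subr_eq0 -{1}[a]mul1r -mulrBl.
by rewrite mulf_eq0 subr_eq0 eq_sym (negbTE r1) => /eqP ->.
Qed.

End plane.

(** * Subsets of the line with small periods *)

Section periodic.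
Variable R : realType.
Local Notation leb := (@lebesgue_measure R).
Local Notation line := (measurableTypeR R).

(** For a period p, an interval [a, b] is a union of k translates of [0, p] up
    to an error of length 2 p, with k p within p of b - a. Hence
    H a b / (b - a) is H 0 p / p up to O(p), and the ratio H 0 p / p is
    eliminated by comparison with the interval [0, 1]. *)
Lemma interval_function_linear (H : R -> R -> R) :
  (forall a b c, a <= b -> b <= c -> H a c = H a b + H b c) ->
  (forall a b, a <= b -> 0 <= H a b <= b - a) ->
  (forall e, 0 < e -> exists p, [/\ 0 < p, p < e &
     forall a b, H (p + a) (p + b) = H a b]) ->
  forall a b, a <= b -> H a b = H 0 1 * (b - a).
Proof.
move=> Hadd Hb Hper.
have approx p a b : 0 < p -> (forall a b, H (p + a) (p + b) = H a b) ->
    a <= b -> `|p * H a b - (b - a) * H 0 p| <= 2 * p ^+ 2.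
  move=> p0 Hp ab.
  have Hn (n : nat) x y : H (n%:R * p + x) (n%:R * p + y) = H x y.
    elim: n => [|n IHn]; first by rewrite mul0r !add0r.
    by rewrite -natr1 mulrDl mul1r ![_ + p]addrC -!addrA Hp.
  have Hz (n : int) x y : H (n%:~R * p + x) (n%:~R * p + y) = H x y.
    case: n => n; first by rewrite -pmulrn Hn.
    rewrite NegzE mulrNz mulNr -pmulrn -[LHS](Hn n.+1).
    by rewrite !addrA subrr !add0r.
  pose n := Num.floor (a / p); pose k := Num.truncn ((b - a) / p).
  have /andP[na an] := floor_itv (a / p).
  rewrite -/n ler_pdivlMr// in na; rewrite -/n ltr_pdivrMr// in an.
  have /truncn_itv/andP[kb bk] : 0 <= (b - a) / p.
    by rewrite divr_ge0 ?subr_ge0// ltW.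
  rewrite -/k ler_pdivlMr// in kb; rewrite -/k ltr_pdivrMr// -natr1 in bk.
  rewrite intrD mulrDl mul1r in an.
  have Hk (m : nat) : H (n%:~R * p) (n%:~R * p + m%:R * p) = m%:R * H 0 p.
    elim: m => [|m IHm].
      rewrite !mul0r addr0; have := Hb (n%:~R * p) _ (lexx _); lra.
    rewrite -natr1 !mulrDl !mul1r -IHm addrA.
    have mp : 0 <= m%:R * p by rewrite mulr_ge0// ltW.
    rewrite (Hadd _ (n%:~R * p + m%:R * p)); [|lra|lra].
    congr (_ + _); rewrite -(Hz n 0 p) addr0 -[RHS](Hn m).
    by congr H; ring.
  have kp : 0 <= k%:R * p by rewrite mulr_ge0// ltW.
  have e1 := Hadd _ _ _ na ab.
  have e2 : H (n%:~R * p) b = k%:R * H 0 p + H (n%:~R * p + k%:R * p) b.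
    by rewrite -Hk -Hadd//; lra.
  have b1 := Hb _ _ na.
  have b2 : 0 <= H (n%:~R * p + k%:R * p) b <= 2 * p.
    by have := Hb (n%:~R * p + k%:R * p) b; lra.
  have b3 : 0 <= H 0 p <= p by have := Hb 0 p; lra.
  move: e1 e2 b1 b2 b3 kb bk.
  move: (H a b) (H _ a) (H 0 p) (H (_ + _) b) (H _ b) => hab ha c hb h.
  move=> e1 e2 b1 b2 b3 kb bk.
  have e3 : hab = k%:R * c + hb - ha by lra.
  have e4 : p * hab - (b - a) * c = (k%:R * p - (b - a)) * c + p * (hb - ha).
    by rewrite e3; ring.
  rewrite e4 ler_norml expr2; apply/andP; split; nra.
move=> a b ab; apply/eqP; rewrite -subr_eq0 -normr_le0.
apply/ler_addgt0Pr => e e0; rewrite add0r.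
have M0 : 0 < 2 * (1 + (b - a)) by lra.
have [p [p0 pe Hp]] := Hper _ (divr_gt0 e0 M0).
have h1 := approx p a b p0 Hp ab.
have h2 := approx p 0 1 p0 Hp ler01.
rewrite ltr_pdivlMr// in pe.
rewrite subr0 mul1r in h2.
rewrite -(ler_pM2l p0) -{1}[p]gtr0_norm// -normrM.
have -> : p * (H a b - H 0 1 * (b - a)) =
  (p * H a b - (b - a) * H 0 p) - (b - a) * (p * H 0 1 - H 0 p) by ring.
apply: (le_trans (ler_normB _ _)); rewrite normrM (@ger0_norm _ (b - a)) ?subr_ge0//.
have : (b - a) * `|p * H 0 1 - H 0 p| <= (b - a) * (2 * p ^+ 2).
  by apply: ler_wpM2l; rewrite ?subr_ge0.
rewrite expr2 in h1 h2 *; nra.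
Qed.

(** The measure of S in an interval is r times its length. If r = 0, S is null;
    otherwise the measure m of the intersection with S satisfies leb = m / r,
    and m gives the complement of S measure 0. *)
Lemma periodic_null_conull (S : set line) : measurable S ->
  (forall e : R, 0 < e -> exists p : R, [/\ 0 < p, p < e &
     forall x, S (p + x) <-> S x]) ->
  leb S = 0%E \/ leb (~` S) = 0%E.
Proof.
move=> mS Sper.
pose m := mrestr leb mS.
have mitv (a b : R) : measurable (`]a, b]%classic : set line).
  exact: measurable_itv.
have fin (a b : R) : a <= b -> (m `]a, b]%classic <= (b - a)%:E)%E.
  move=> ab; apply: (@le_trans _ _ (leb `]a, b]%classic)).
    apply: le_measure; rewrite ?inE//; exact: measurableI.
  rewrite lebesgue_measure_itv/= lte_fin.
  by case: ifP; rewrite ?EFinB// lee_fin subr_ge0.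
have finm (a b : R) : a <= b -> m `]a, b]%classic \is a fin_num.
  move=> ab; rewrite ge0_fin_numE//; exact: le_lt_trans (fin _ _ ab) (ltry _).
pose H (a b : R) := fine (m `]a, b]%classic).
have HE a b : a <= b -> m `]a, b]%classic = (H a b)%:E.
  by move=> ab; rewrite /H fineK ?finm.
have lin : forall a b, a <= b -> H a b = H 0 1 * (b - a).
  apply: interval_function_linear.
  - move=> a b c ab bc; apply: EFin_inj; rewrite EFinD -!HE ?(le_trans ab bc)//.
    rewrite -measureU//.
      congr (m _); apply/seteqP; split => x /=; rewrite !in_itv/=.
        move=> /andP[ax xc]; have [xb|xb] := leP x b; [left|right]; lra.
      by case; lra.
    by apply/seteqP; split => // x [] /=; rewrite !in_itv/=; lra.
  - move=> a b ab; rewrite -!lee_fin -HE// fin// andbT; exact: measure_ge0.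
  - move=> e /Sper[p [p0 pe Sp]]; exists p; split => // a b.
    congr fine; rewrite /m /mrestr.
    rewrite -(lebesgue_measure_translate p); last exact: measurableI.
    congr (leb _); apply/seteqP; split => x /= [xab /Sp Sx]; split => //.
      by move: xab; rewrite !in_itv/= ltrD2l lerD2l.
    by move: xab; rewrite !in_itv/= ltrD2l lerD2l.
have [r0|r0] := eqVneq (H 0 1) 0; [left|right].
  have SE : S = \bigcup_n (S `&` `](- n%:R)%R, n%:R]%classic).
    rewrite -setI_bigcupr; apply/esym/setIidl => x _.
    exists (Num.truncn `|x|).+1 => //=; rewrite in_itv/=.
    have := truncnS_gt `|x|; rewrite ltr_norml => /andP[-> /ltW ->].
    by [].
  rewrite SE; apply/negligibleP.
    by apply: bigcupT_measurable => n; exact: measurableI.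
  apply: negligible_bigcup => n; apply/negligibleP; first exact: measurableI.
  have nn : (- n%:R)%R <= n%:R :> R by rewrite lerNl (le_trans (_ : _ <= 0)).
  by have := HE _ _ nn; rewrite lin// r0 mul0r /m /mrestr setIC.
have rge0 : 0 <= H 0 1 by rewrite fine_ge0.
have rp : 0 <= (H 0 1)^-1 by rewrite invr_ge0.
have mC : measurable (~` S) by exact: measurableC.
rewrite (@lebesgue_measure_unique R (mscale (NngNum rp) m)) //.
  have mSC : m (~` S) = 0%E by rewrite /m /mrestr setICl measure0.
  by transitivity ((H 0%R 1%R)^-1%:E * m (~` S))%E; [|rewrite mSC mule0].
move=> _ [[a b] _ <-].
transitivity ((H 0%R 1%R)^-1%:E * m `]a, b]%classic)%E; last by [].
have [ab|ba] := leP a b.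
  rewrite HE// (lin _ _ ab) -EFinM mulKf// lebesgue_measure_itv/= lte_fin.
  case: ltP => // ba; congr _%:E; apply/eqP; rewrite eq_sym subr_eq0 eq_le.
  by rewrite ab ba.
rewrite set_itv_ge ?bnd_simp -?leNgt ?ltW// measure0.
by rewrite /m /mrestr set0I measure0 mule0.
Qed.
End periodic.

(** If the positive elements of the group G = Z x + Z y were at least e, two
    elements of G closer than e would be equal, so an element g of G within e of
    the infimum of the positive ones would generate G, and x / y would be
    rational. *)
Lemma small_integer_combination (R : realType) (x y e : R) : y != 0 ->
  (forall q : rat, x != ratr q * y) -> 0 < e ->
  exists m n : int, 0 < m%:~R * x + n%:~R * y < e.
Proof.
move=> y0 xy e0; apply: contrapT => no.
have {}no (m n : int) : 0 < m%:~R * x + n%:~R * y -> e <= m%:~R * x + n%:~R * y.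
  by move=> h; rewrite leNgt; apply/negP => h'; apply: no; exists m, n; rewrite h.
pose G := [set g | exists m n : int, g = m%:~R * x + n%:~R * y].
have GB g h (k : int) : G g -> G h -> G (g - k%:~R * h).
  move=> [m [n ->]] [m' [n' ->]]; exists (m - k * m'), (n - k * n').
  by rewrite !intrB !intrM; ring.
have {}no g : G g -> 0 < g -> e <= g by move=> [m [n ->]]; exact: no.
pose P := [set g | G g /\ 0 < g].
have infP : has_inf P.
  split; last by exists 0 => g [_ /ltW].
  have [y1|y1] := ltP 0 y.
    by exists y; split => //; exists 0, 1; rewrite mul0r add0r mul1r.
  exists (- y); split; last by rewrite oppr_gt0 lt_neqAle y0.
  by exists 0, (-1); rewrite mul0r add0r mulN1r.
have [g [Gg g0] gP] := inf_adherent e0 infP.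
have mult h : G h -> h = (Num.floor (h / g))%:~R * g.
  move=> Gh; have /andP[h1 h2] := floor_itv (h / g).
  rewrite ler_pdivlMr// in h1; rewrite ltr_pdivrMr// intrD mulrDl mul1r in h2.
  set k := Num.floor _ in h1 h2 *.
  apply/eqP; rewrite -subr_eq0; apply/negPn/negP => r0.
  have Gr := GB _ _ k Gh Gg.
  have rpos : 0 < h - k%:~R * g by rewrite lt_neqAle eq_sym r0 subr_ge0.
  have r1 : inf P <= h - k%:~R * g by apply: ge_inf; [exact: infP.2|split].
  have := no _ (GB _ _ 1 Gg Gr); rewrite mul1r => /(_ _); lra.
have Gx : G x by exists 1, 0; rewrite mul0r addr0 mul1r.
have Gy : G y by exists 0, 1; rewrite mul0r add0r mul1r.
have := mult _ Gy; have := mult _ Gx.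
move: (Num.floor _) (Num.floor _) => l k xE yE.
have l0 : l%:~R != 0 :> R.
  by apply/eqP => l0; move: y0; rewrite yE l0 mul0r eqxx.
have := xy (k%:~R / l%:~R); rewrite fmorph_div !rmorph_int [in X in _ * X]yE.
by rewrite mulrA divfK// -xE eqxx.
Qed.

(** * Block matrices acting on R x R^n *)

Section block.
Variables (R : realType) (n : nat).

Lemma cons_cVE (t : R) (y : 'cV[R]_n) :
  @cons_cV R n (t, y) = col_mx (t%:M : 'M[_]_1) y :> 'cV_(1 + n).
Proof.
apply/colP => i; rewrite !mxE; case: splitP => j ij.
  have -> : i = ord0 by apply/val_inj; rewrite /= ij ord1.
  by rewrite unlift_none !mxE ord1.
have -> : i = lift ord0 j by apply/val_inj; rewrite /= ij.
by rewrite liftK.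
Qed.

Lemma e1_consE : e1 R n.+1 = @cons_cV R n (1, 0).
Proof.
apply/colP => i; rewrite !mxE; case: unliftP => [j ->|->] /=; last by [].
by rewrite mxE.
Qed.

Lemma block_cons_cV (a : R) (b : 'rV[R]_n) (c : 'cV[R]_n) (d : 'M[R]_n)
    (t : R) (y : 'cV[R]_n) :
  (block_mx (a%:M : 'M[_]_1) b c d : 'M[_]_n.+1) *m
    (@cons_cV R n (t, y) : 'cV_n.+1) =
  @cons_cV R n (a * t + (b *m y) ord0 ord0, t *: c + d *m y).
Proof.
rewrite !cons_cVE (mul_block_col (a%:M : 'M[_]_1)) !mul_mx_scalar.
apply: (congr2 (@col_mx R 1 n 1)) => //.
by apply/matrixP => i j; rewrite !ord1 !mxE eqxx !mulr1n mulrC.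
Qed.
End block.

Section orbit.
Variables (R : realType) (n : nat).

Lemma SLZ_unitmx (M : 'M[R]_n) : SLZ M -> M \in unitmx.
Proof. by case=> A dA <-; rewrite unitmxE det_map_mx dA rmorph1 unitr1. Qed.

Lemma invariant_iff (M : 'M[R]_n) (A : set (borel_cV R n)) x : SLZ M ->
  @linear_action R n M @` A = A -> A (M *m (x : 'cV_n)) <-> A x.
Proof.
move=> /SLZ_unitmx uM MA; split => [|Ax].
  rewrite -{1}MA => -[z Az]; rewrite /linear_action => /(congr1 (mulmx (invmx M))).
  by rewrite !mulKmx// => <-.
by rewrite -MA; exists x.
Qed.

Lemma invariant_image (M : 'M[R]_n) (A : set (borel_cV R n)) : SLZ M ->
  (forall x : 'cV_n, A (M *m x) <-> A x) -> @linear_action R n M @` A = A.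
Proof.
move=> /SLZ_unitmx uM MA; apply/seteqP; split => [_ [x Ax <-]|x Ax].
  by apply/MA.
by exists (invmx M *m (x : 'cV_n)); rewrite /linear_action ?mulKVmx// -MA mulKVmx.
Qed.
End orbit.

Section unipotent.
Variables (R : realType) (n : nat).

Lemma upper_Gamma0 (b : 'rV[int]_n) (B : 'M[int]_n) : \det B = 1 ->
  Gamma0 (block_mx (1%:M : 'M[R]_1) (map_mx intr b) 0 (map_mx intr B) : 'M[_]_n.+1).
Proof.
move=> dB; split; last first.
  by rewrite e1_consE block_cons_cV !mulmx0 mxE addr0 mul1r scaler0 addr0.
exists (block_mx (1%:M : 'M[_]_1) b 0 B : 'M[_]_n.+1).
  by rewrite /= (det_ublock (1%:M : 'M[_]_1)) det1 dB mulr1.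
by rewrite (map_block_mx _ (1%:M : 'M[_]_1)) map_mx1 map_mx0.
Qed.

Lemma lower_SLZ (c : 'cV[int]_n) :
  SLZ (block_mx (1%:M : 'M[R]_1) 0 (map_mx intr c) 1%:M : 'M[_]_n.+1).
Proof.
exists (block_mx (1%:M : 'M[_]_1) 0 c 1%:M : 'M[_]_n.+1).
  by rewrite /= (det_lblock (1%:M : 'M[_]_1)) !det1 mulr1.
by rewrite (map_block_mx _ (1%:M : 'M[_]_1)) !map_mx1 map_mx0.
Qed.
End unipotent.

(** * Fibration over the last coordinates *)

Section fibres.
Variable R : realType.
Local Notation leb := (@lebesgue_measure R).
Local Notation line := (measurableTypeR R).

Lemma lebesgue_cVSE n (A : set (borel_cV R n.+1)) :
  lebesgue_cV R n.+1 A = (leb \x lebesgue_cV R n)%E (@cons_cV R n @^-1` A).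
Proof. by []. Qed.

Lemma measurable_cons_preimage n (A : set (borel_cV R n.+1)) :
  measurable A -> measurable (@cons_cV R n @^-1` A).
Proof. exact: measurable_preimageT (@measurable_cons_cV R n). Qed.

Lemma null_of_fibres n (B : set (line * borel_cV R n)) N : measurable B ->
  (lebesgue_cV R n).-negligible N ->
  (forall y, ~ N y -> leb (ysection B y) = 0%E) ->
  (leb \x lebesgue_cV R n)%E B = 0%E.
Proof.
move=> mB nN BN; rewrite product_measure12E//.
have mf : measurable_fun setT (leb \o ysection B).
  exact: measurable_fun_ysection.
transitivity (\int[lebesgue_cV R n]_y cst 0%E y)%E; last by rewrite integral0.
apply: ge0_ae_eq_integral => //.
case: nN => M [mM M0 NM]; exists M; split => // y /= yB.
by apply: NM; apply: contrapT => /BN h; apply: yB.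
Qed.

Definition coord0 n (y : borel_cV R n.+1) : line := (y : 'cV_n.+1) ord0 ord0.
Definition coord1 n (y : borel_cV R n.+2) : line :=
  (y : 'cV_n.+2) (lift ord0 ord0) ord0.

Lemma measurable_coord0 n : measurable_fun setT (@coord0 n).
Proof. exact: measurableT_comp measurable_fst (@measurable_uncons_cV R n). Qed.

Lemma measurable_coord1 n : measurable_fun setT (@coord1 n).
Proof.
have -> : @coord1 n = @coord0 n \o snd \o @uncons_cV R n.+1.
  by apply/funext => y; rewrite /coord0 /coord1 /uncons_cV /= mxE.
apply: measurableT_comp; last exact: measurable_uncons_cV.
exact: measurableT_comp (@measurable_coord0 n) measurable_snd.
Qed.

Lemma measurable_coord_eq n r :
  measurable [set y : borel_cV R n.+2 | coord0 y == r * coord1 y].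
Proof.
apply: measurable_set_bool; apply: measurable_fun_eqr.
  exact: measurable_coord0.
apply: measurable_funM; first exact: measurable_cst.
exact: measurable_coord1.
Qed.

Lemma measurable_coord0_eq n c :
  measurable [set y : borel_cV R n.+1 | coord0 y == c].
Proof.
apply: measurable_set_bool; apply: measurable_fun_eqr.
  exact: measurable_coord0.
exact: measurable_cst.
Qed.

Lemma coord0_cons n p : coord0 (@cons_cV R n p) = p.1.
Proof. by rewrite /coord0 mxE unlift_none. Qed.

Lemma coord1_cons n p : coord1 (@cons_cV R n.+1 p) = coord0 p.2.
Proof. by rewrite /coord1 mxE liftK. Qed.

Lemma null_coord_eq n r :
  lebesgue_cV R n.+2 [set y | coord0 y == r * coord1 y] = 0%E.
Proof.
rewrite lebesgue_cVSE; apply: (@null_of_fibres _ _ set0).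
- by apply: measurable_cons_preimage; exact: measurable_coord_eq.
- exact: negligible_set0.
move=> y _; rewrite (_ : ysection _ _ = [set r * coord0 y]).
  exact: lebesgue_measure_set1.
apply/seteqP; split => t; rewrite ysectionP /= coord0_cons coord1_cons /=.
  by move/eqP.
by move=> ->.
Qed.

Lemma null_coord0_eq n c : lebesgue_cV R n.+1 [set y | coord0 y == c] = 0%E.
Proof.
rewrite lebesgue_cVSE; apply: (@null_of_fibres _ _ set0).
- by apply: measurable_cons_preimage; exact: measurable_coord0_eq.
- exact: negligible_set0.
move=> y _; rewrite (_ : ysection _ _ = [set c]).
  exact: lebesgue_measure_set1.
apply/seteqP; split => t; rewrite ysectionP /= coord0_cons /=.
  by move/eqP.
by move=> ->.
Qed.

Lemma null_coord1_eq0 n : lebesgue_cV R n.+2 [set y | coord1 y == 0] = 0%E.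
Proof.
rewrite lebesgue_cVSE.
rewrite (_ : _ @^-1` _ = setT `*` [set y | coord0 y == 0]).
  rewrite product_measure1E//; last exact: measurable_coord0_eq.
  by rewrite [X in (_ * X)%E]null_coord0_eq mule0.
by apply/seteqP; split => -[t y]; rewrite /= coord1_cons //; case.
Qed.

(** Outside this set the first two coordinates are linearly independent over Q,
    so they generate a dense subgroup of the line. *)
Definition commensurable n : set (borel_cV R n.+2) :=
  [set y | coord1 y == 0] `|`
  \bigcup_(q : rat) [set y | coord0 y == ratr q * coord1 y].

Lemma negligible_commensurable n :
  (lebesgue_cV R n.+2).-negligible (@commensurable n).
Proof.
pose mu := lebesgue_cV R n.+2.
apply: negligibleU.
  apply/negligibleP; last exact: null_coord1_eq0.
  apply: measurable_set_bool; apply: measurable_fun_eqr.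
    exact: measurable_coord1.
  exact: measurable_cst.
have mq (q : rat) := @measurable_coord_eq n (ratr q).
apply/negligibleP; first exact: bigcupT_measurable_rat.
apply/eqP; rewrite -measure_le0.
pose F k : set (borel_cV R n.+2) := if unpickle k is Some q then
  [set y | coord0 y == ratr (q : rat) * coord1 y] else set0.
have mF k : measurable (F k) by rewrite /F; case: (unpickle k).
have FN : mu.-negligible (\bigcup_k F k).
  apply: negligible_bigcup => k; apply/negligibleP => //; rewrite /F.
  by case: (unpickle k) => [q|]; [exact: null_coord_eq|exact: measure0].
have /negligibleP <- := FN; last exact: bigcupT_measurable.
apply: le_measure; rewrite ?inE; first exact: bigcupT_measurable_rat.
  exact: bigcupT_measurable.
by move=> y [q _ yq]; exists (pickle q); [exact: I|rewrite /F pickleK].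
Qed.

End fibres.

Section fibration.
Variables (R : realType) (n : nat).
Local Notation leb := (@lebesgue_measure R).
Local Notation mu := (lebesgue_cV R n.+2).

Lemma integer_row_mul (k l : int) (y : 'cV[R]_n.+2) :
  (map_mx intr (k *: delta_mx ord0 ord0 +
    l *: delta_mx ord0 (lift ord0 ord0) : 'rV[int]_n.+2) *m y) ord0 ord0 =
  k%:~R * coord0 y + l%:~R * coord1 y.
Proof.
rewrite mxE (bigD1 ord0)//= (bigD1 (lift ord0 ord0))//= big1 => [|j].
  by rewrite !mxE !eqxx/= !mulr1 !mulr0 addr0 add0r addr0.
by rewrite !mxE => /andP[/negbTE -> /negbTE ->]; rewrite !mulr0 addr0 mul0r.
Qed.

(** The matrices (1 b; 0 1) make almost every fibre of an invariant set null or
    conull, and the matrices (1 0; 0 D) make the set E of the base points with a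
    null fibre invariant under SL(n + 2, Z). According to whether E is null or
    conull, A is conull or null by Fubini. *)
Lemma Gamma0_ergodic_of_SLZ :
  ergodic_action mu (@SLZ R n.+2) (@linear_action R n.+2) ->
  ergodic_action (lebesgue_cV R n.+3) (@Gamma0 R n.+3) (@linear_action R n.+3).
Proof.
move=> erg A mA Ainv.
pose B := @cons_cV R n.+2 @^-1` A.
have mB : measurable B by exact: measurable_cons_preimage.
have Binv (b : 'rV[int]_n.+2) (D : 'M[int]_n.+2) t (y : 'cV[R]_n.+2) : \det D = 1 ->
    B (t + (map_mx intr b *m y) ord0 ord0, map_mx intr D *m y) <-> B (t, y).
  move=> dD; have hG := @upper_Gamma0 R _ b D dD.
  have := invariant_iff (@cons_cV R n.+2 (t, y)) hG.1 (Ainv _ hG).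
  by rewrite block_cons_cV mul1r scaler0 add0r.
have fib y : ~ commensurable y ->
    leb (ysection B y) = 0%E \/ leb (~` (ysection B y)) = 0%E.
  move=> ny; apply: periodic_null_conull; first exact: measurable_ysection.
  move=> e e0.
  have [||k [l /andP[kl0 kle]]] :=
    @small_integer_combination R (coord0 y) (coord1 y) e _ _ e0.
  - by apply/eqP => y1; apply: ny; left; apply/eqP.
  - by move=> q; apply/negP => yq; apply: ny; right; exists q.
  exists (k%:~R * coord0 y + l%:~R * coord1 y); split => // t.
  rewrite !ysectionP.
  have := Binv (k *: delta_mx ord0 ord0 + l *: delta_mx ord0 (lift ord0 ord0))
    1%:M t y (det1 _ _).
  rewrite map_mx1 mul1mx [_ + t]addrC.
  by rewrite (integer_row_mul k l y).
pose E := [set y | leb (ysection B y) = 0%E] : set (borel_cV R n.+2).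
have mf : measurable_fun setT (leb \o ysection B).
  exact: measurable_fun_ysection.
have mE : measurable E.
  by rewrite -[E]setTI; apply: (mf measurableT [set 0%E]).
have Einv M : SLZ M -> @linear_action R n.+2 M @` E = E.
  move=> sM; apply: invariant_image => // y; case: sM => D dD <-.
  rewrite /E /= (_ : ysection B _ = ysection B y)//.
  apply/seteqP; split => t; rewrite !ysectionP.
    by have := Binv 0 D t y dD; rewrite map_mx0 mul0mx mxE addr0 => ->.
  by have := Binv 0 D t y dD; rewrite map_mx0 mul0mx mxE addr0 => ->.
have nc := @negligible_commensurable R n.
have [E0|E0] := erg E mE Einv; [right|left];
  apply: (etrans (lebesgue_cVSE _)).
  have -> : @cons_cV R n.+2 @^-1` (~` A) = ~` B by [].
  apply: (@null_of_fibres _ _ _ (E `|` @commensurable R n)).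
  - exact: measurableC.
  - by apply: negligibleU => //; exact/negligibleP.
  move=> y yE; rewrite (_ : ysection _ _ = ~` ysection B y).
    by have [h|//] := fib y (fun c => yE (or_intror c)); case: yE; left.
  by apply/seteqP; split => t; rewrite /= !ysectionP.
apply: (@null_of_fibres _ _ _ (~` E)) => //.
- by apply/negligibleP => //; exact: measurableC.
- by move=> y /contrapT.
Qed.
End fibration.

(** * Ergodicity in all dimensions *)

Section base.
Variable R : realType.
Local Notation leb := (@lebesgue_measure R).
Local Notation line := (measurableTypeR R).
Local Notation area := (leb \x leb)%E.

Lemma lebesgue_cV1E (Z : set (borel_cV R 1)) : measurable Z ->
  lebesgue_cV R 1 Z = leb [set s | Z (@cons_cV R 0 (s, 0))].
Proof.
move=> mZ; rewrite lebesgue_cVSE.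
have mZ' := measurable_cons_preimage mZ.
have mS := measurable_ysection (0 : borel_cV R 0) mZ'.
have -> : [set s | Z (@cons_cV R 0 (s, 0))] =
    ysection (@cons_cV R 0 @^-1` Z) (0 : borel_cV R 0).
  by apply/seteqP; split => s; rewrite ysectionP.
transitivity (\int[leb]_s (\1_(ysection (@cons_cV R 0 @^-1` Z)
    (0 : borel_cV R 0)) s)%:E)%E; last by rewrite integral_indic ?setIT.
apply: eq_integral => s _ /=; rewrite diracE indicE.
by rewrite mem_xsection mem_ysection.
Qed.

Definition plane_cV (p : line * line) : borel_cV R 2 :=
  @cons_cV R 1 (p.1, @cons_cV R 0 (p.2, 0)).

Lemma measurable_plane_cV : measurable_fun setT plane_cV.
Proof.
apply: (measurableT_comp (@measurable_cons_cV R 1)).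
apply: measurable_fun_pair; first exact: measurable_fst.
apply: (measurableT_comp (@measurable_cons_cV R 0)).
by apply: measurable_fun_pair; [exact: measurable_snd|exact: measurable_cst].
Qed.

Lemma lebesgue_cV2E (A : set (borel_cV R 2)) : measurable A ->
  lebesgue_cV R 2 A = area (plane_cV @^-1` A).
Proof.
move=> mA; rewrite lebesgue_cVSE; apply: eq_integral => s _.
have mAs := measurable_xsection s (measurable_cons_preimage mA).
exact: etrans (lebesgue_cV1E mAs) _.
Qed.

Lemma plane_cV_shear1 p : plane_cV (shear1 p) =
  (block_mx (1%:M : 'M[R]_1) (map_mx intr (const_mx 1)) 0 (map_mx intr 1%:M)
    : 'M[R]_2) *m (plane_cV p : 'cV[R]_2).
Proof.
case: p => x y; rewrite /plane_cV block_cons_cV mul1r scaler0 add0r.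
by rewrite map_mx1 mul1mx mxE big_ord1 !mxE unlift_none mul1r.
Qed.

Lemma plane_cV_shear2 p : plane_cV (shear2 p) =
  (block_mx (1%:M : 'M[R]_1) 0 (map_mx intr (const_mx 1)) 1%:M
    : 'M[R]_2) *m (plane_cV p : 'cV[R]_2).
Proof.
case: p => x y; rewrite /plane_cV block_cons_cV mul1r mul0mx mxE addr0 mul1mx.
congr (cons_cV (_, _)); apply/colP => i; rewrite !mxE.
by case: unliftP => [[]//|_]; rewrite /= mulr1.
Qed.

Lemma SLZ2_ergodic :
  ergodic_action (lebesgue_cV R 2) (@SLZ R 2) (@linear_action R 2).
Proof.
move=> A mA Ainv.
have mB : measurable (plane_cV @^-1` A).
  exact: measurable_preimageT measurable_plane_cV mA.
have [||B0|B0] := @plane_ergodic R (plane_cV @^-1` A) mB.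
- apply/seteqP; split => p /=; rewrite plane_cV_shear1.
    have hG := @upper_Gamma0 R 1 (const_mx 1) 1%:M (det1 _ _).
    by move/(invariant_iff (plane_cV p) hG.1 (Ainv _ hG.1)).
  have hG := @upper_Gamma0 R 1 (const_mx 1) 1%:M (det1 _ _).
  by move=> h; apply/(invariant_iff (plane_cV p) hG.1 (Ainv _ hG.1)).
- have hS := @lower_SLZ R 1 (const_mx 1).
  apply/seteqP; split => p /=; rewrite plane_cV_shear2.
    by move/(invariant_iff (plane_cV p) hS (Ainv _ hS)).
  by move=> h; apply/(invariant_iff (plane_cV p) hS (Ainv _ hS)).
- by left; exact: etrans (lebesgue_cV2E mA) _.
by right; exact: etrans (lebesgue_cV2E (measurableC mA)) _.
Qed.

End base.

(** SL(n + 1, Z) contains Gamma_0, so its invariant sets are among those to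
    which the reduction to SL(n, Z) applies. *)
Lemma SLZ_ergodic (R : realType) n :
  ergodic_action (lebesgue_cV R n.+2) (@SLZ R n.+2) (@linear_action R n.+2).
Proof.
elim: n => [|n IHn]; first exact: SLZ2_ergodic.
move=> A mA Ainv; apply: (Gamma0_ergodic_of_SLZ IHn) => // M [sM _].
exact: Ainv.
Qed.

Theorem proposition4p5 (R : realType) (n : nat) (hn : (3 <= n)%N) :
  ergodic_action (lebesgue_cV R n) (@Gamma0 R n) (@linear_action R n).
Proof.
case: n hn => [|[|[|n]]] // _.
exact/Gamma0_ergodic_of_SLZ/SLZ_ergodic.
Qed.
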